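(* Let $A$ be a commutative ring, let $f(x)\in A[x]$ be a monic polynomial of degree $n$, and let $r,n_1,\dots,n_r\in\mathbb N$ with $n_1+\dots+n_r\le n$. Let $R=A[c_{ij}\mid 1\le i\le r,\ 1\le j\le n_i]$, let $g_i=x^{n_i}+c_{i1}x^{n_i-1}+\dots+c_{in_i}\in R[x]$ for $1\le i\le r$, let $I\subseteq R$ be the ideal generated by the coefficients of the remainder of $f$ upon division by $g_1g_2\cdots g_r$ in $R[x]$, and set $\mathrm{PF}_{n_1,\dots,n_r}(f):=R/I$. Set $\deg(c_{ij})=j$, equip each monoid $[c_{i1},\dots,c_{in_i}]$ with the graded reverse lexicographic ordering with $c_{i1}>\dots>c_{in_i}$, and equip the monoid of all monomials of $R$ with the block ordering $[c_{r1},\dots,c_{rn_r}]\gg[c_{r-1,1},\dots,c_{r-1,n_{r-1}}]\gg\dots\gg[c_{11},\dots,c_{1n_1}]$. Then: 1. $I$ is monic over $A$ (with respect to this block ordering); 2. the lead term ideal of $I$ (with respect to this block ordering) is $$\ell(I)=\langle c_{11},\dots,c_{1n_1}\rangle^{n-n_1+1}+\langle c_{21},\dots,c_{2n_2}\rangle^{n-n_1-n_2+1}+\dots+\langle c_{r1},\dots,c_{rn_r}\rangle^{n-n_1-n_2-\dots-n_r+1};$$ 3. a basis for $\mathrm{PF}_{n_1,\dots,n_r}(f)$ as an $A$-module is provided by the images of the monomials $c^\alpha=\prod_{i,j}c_{ij}^{\alpha_{ij}}$ satisfying, for every $i=1,\dots,r$, the inequality $$\alpha_{i1}+\dots+\alpha_{in_i}\le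 n-n_r-n_{r-1}-\dots-n_i;$$ 4. $R/I$ is a free $A$-module of rank $$\binom{n}{n_r}\binom{n-n_r}{n_{r-1}}\binom{n-n_r-n_{r-1}}{n_{r-2}}\cdots\binom{n-n_r-\dots-n_2}{n_1}.$$
   Context: A monomial ordering is a total ordering on the monomials, compatible with multiplication, that is a well-ordering. For an ideal $I$ of a polynomial ring over $A$, $\ell(I)$ denotes the ideal generated by the lead terms (lead coefficient times lead monomial) of the nonzero elements of $I$; $I$ is called monic if $\ell(I)$ can be generated by a set of monomials (with coefficient $1$). Graded reverse lexicographic ordering on $[c_{1},\dots,c_{m}]$ with $\deg c_i=i$ and $c_1>\dots>c_m$: $c^\alpha>c^\gamma$ if and only if either $\sum_i i\alpha_i>\sum_i i\gamma_i$, or $\sum_i i\alpha_i=\sum_i i\gamma_i$ and for some $l$ one has $\alpha_l<\gamma_l$ and $\alpha_k=\gamma_k$ for all $k>l$. Block ordering $[x]\gg[t]$ on monomials in two disjoint sets of variables with given monomial orderings: $x^\alpha t^\beta<x^\gamma t^\delta$ iff either $x^\alpha<x^\gamma$, or $x^\alpha=x^\gamma$ and $t^\beta<t^\delta$. It is iterated for more than two blocks (the leftmost block is compared first). *)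

(* Defs.v *)
From HB Require Import structures.
From mathcomp Require Import all_boot all_order all_algebra.
From mathcomp Require Import mpoly.
From mathcomp Require Import boolp.

Set Implicit Arguments.
Unset Strict Implicit.
Unset Printing Implicit Defensive.

Import GRing.Theory.
Local Open Scope quotient_scope.
Local Open Scope ring_scope.

Section Ideals.
Variable R : comNzRingType.

(* Membership in an ideal is undecidable in general; the classical [asbool]
   makes it boolean, as the quotient construction requires. *)
Definition ideal_gen (S : R -> Prop) : {pred R} := fun p =>
  `[< exists (k : nat) (a s : 'I_k -> R),
        (forall i, S (s i)) /\ p = \sum_(i < k) a i * s i >].

Definition ideal_exp (I : {pred R}) (k : nat) : {pred R} :=
  ideal_gen (fun p =>
    exists2 s : 'I_k -> R, forall i, s i \in I & p = \prod_(i < k) s i).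

Definition ideal_sum (r : nat) (I : 'I_r -> {pred R}) : {pred R} := fun p =>
  `[< exists2 q : 'I_r -> R, forall i, q i \in I i & p = \sum_(i < r) q i >].

Lemma ideal_gen_mull S a p : p \in ideal_gen S -> a * p \in ideal_gen S.
Proof.
move=> /asboolP [k [b [s [Ss ->]]]]; apply/asboolP.
exists k, (fun i => a * b i), s; split=> //.
by rewrite mulr_sumr; apply: eq_bigr => i _; rewrite mulrA.
Qed.

Lemma ideal_gen_zmod_closed S : zmod_closed (ideal_gen S).
Proof.
have addS : {in ideal_gen S &, forall p q, p + q \in ideal_gen S}.
  move=> _ _ /asboolP [k [a [s [Ss ->]]]] /asboolP [l [b [t [St ->]]]].
  apply/asboolP; exists (k + l)%N.
  exists (fun i => match split i with inl j => a j | inr j => b j end).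
  exists (fun i => match split i with inl j => s j | inr j => t j end).
  split=> [i|]; first by case: (split i).
  rewrite big_split_ord /=; congr (_ + _); apply: eq_bigr => i _.
    by rewrite (unsplitK (inl i : 'I_k + 'I_l)).
  by rewrite (unsplitK (inr i : 'I_k + 'I_l)).
split=> [|p q Ip Iq]; last by rewrite addS // -mulN1r ideal_gen_mull.
by apply/asboolP; exists 0, (fun=> 0), (fun=> 0); split=> [[]|]; rewrite ?big_ord0.
Qed.

HB.instance Definition _ S :=
  GRing.isZmodClosed.Build R (ideal_gen S) (ideal_gen_zmod_closed S).

End Ideals.

Section IdealQuotient.
Variables (A : comNzRingType) (R : comAlgType A) (S : R -> Prop).

(* [{ideal_quot I}] carries a ring structure in the library only for proper
   ideals, and no module structure; a generated ideal may be the unit ideal. *)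
Definition ideal_quotient : Type := {ideal_quot (ideal_gen S)}.
HB.instance Definition _ := GRing.Zmodule.on ideal_quotient.

Definition residue (p : R) : ideal_quotient :=
  \pi_{ideal_quot (ideal_gen S)} p.

Definition quotient_scale (a : A) (x : ideal_quotient) : ideal_quotient :=
  residue (a *: repr (x : {ideal_quot (ideal_gen S)})).

Lemma residue_repr (x : ideal_quotient) :
  residue (repr (x : {ideal_quot (ideal_gen S)})) = x.
Proof. exact: reprK. Qed.

Lemma residueD p q : residue (p + q) = residue p + residue q.
Proof. exact: (raddfD \pi_{ideal_quot (ideal_gen S)}). Qed.

Lemma eq_residue p q : residue p = residue q <-> p - q \in ideal_gen S.
Proof. by rewrite Quotient.idealrBE; split=> /eqP. Qed.

Lemma residueZ a p : residue (a *: p) = quotient_scale a (residue p).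
Proof.
apply/eq_residue; rewrite -scalerBr -mulr_algl ideal_gen_mull //.
by apply/eq_residue; rewrite residue_repr.
Qed.

Lemma quotient_scaleA a b x :
  quotient_scale a (quotient_scale b x) = quotient_scale (a * b) x.
Proof. by rewrite -[x]residue_repr -!residueZ scalerA. Qed.

Lemma quotient_scale1 : left_id 1 quotient_scale.
Proof. by move=> x; rewrite -[x]residue_repr -residueZ scale1r. Qed.

Lemma quotient_scaleDr : right_distributive quotient_scale +%R.
Proof.
move=> a x y; rewrite -[x]residue_repr -[y]residue_repr.
by rewrite -residueD -!residueZ -residueD scalerDr.
Qed.

Lemma quotient_scaleDl x : {morph quotient_scale^~ x : a b / a + b}.
Proof.
by move=> a b; rewrite -[x]residue_repr -!residueZ -residueD scalerDl.
Qed.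

HB.instance Definition _ :=
  GRing.Zmodule_isLmodule.Build A ideal_quotient
    quotient_scaleA quotient_scale1 quotient_scaleDr quotient_scaleDl.

End IdealQuotient.

Section Bases.
Variables (A : comNzRingType) (V : lmodType A).

Definition is_basis (J : eqType) (v : J -> V) : Prop :=
  (forall x : V, exists (s : seq J) (a : J -> A),
     x = \sum_(j <- s) a j *: v j) /\
  (forall (s : seq J) (a : J -> A), uniq s ->
     \sum_(j <- s) a j *: v j = 0 -> forall j, j \in s -> a j = 0).

Definition free_of_rank (k : nat) : Prop := exists v : 'I_k -> V, is_basis v.

End Bases.

Section LeadTerms.
Variables (A : comNzRingType) (N : nat) (lt : rel 'X_{1..N}).

(* Forces [p != 0], since the zero polynomial has empty support. *)
Definition is_lead_monomial (p : {mpoly A[N]}) (m : 'X_{1..N}) : Prop :=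
  m \in msupp p /\ forall m', m' \in msupp p -> m' != m -> lt m' m.

Definition lead_ideal (I : {pred {mpoly A[N]}}) : {pred {mpoly A[N]}} :=
  ideal_gen (fun t => exists p m,
    [/\ p \in I, is_lead_monomial p m & t = p@_m *: 'X_[m]]).

Definition monic_ideal (I : {pred {mpoly A[N]}}) : Prop :=
  exists M : 'X_{1..N} -> Prop,
    lead_ideal I =i ideal_gen (fun t => exists2 m, M m & t = 'X_[A, m]).

End LeadTerms.

Section Grevlex.
Variable d : nat.
Implicit Types a b : 'I_d -> nat.

(* The variable with 0-based index [j] has degree [j.+1]. *)
Definition wdeg a : nat := (\sum_(j < d) j.+1 * a j)%N.

Definition grevlex_lt a b : bool :=
  (wdeg a < wdeg b)%N ||
  (wdeg a == wdeg b) &&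
  [exists l : 'I_d, (b l < a l)%N && [forall k : 'I_d, (l < k)%N ==> (b k == a k)]].

End Grevlex.

Section Blocks.
Variables (r : nat) (n_ : 'I_r -> nat).
Local Notation N := (\sum_(i < r) n_ i)%N.

(* All variables are numbered by ['I_N]; [tagnat.Rank i j] is the
   number of the variable with (0-based) position [j] in block [i]. *)
Definition block (m : 'X_{1..N}) (i : 'I_r) : 'I_(n_ i) -> nat :=
  fun j => m (tagnat.Rank i j).

Definition bdeg (m : 'X_{1..N}) (i : 'I_r) : nat :=
  (\sum_(j < n_ i) block m j)%N.

(* The block with the largest index is compared first. *)
Definition block_lt : rel 'X_{1..N} := fun m m' =>
  [exists i : 'I_r, grevlex_lt (@block m i) (@block m' i) &&
     [forall k : 'I_r, (i < k)%N ==> [forall j, @block m k j == @block m' k j]]].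

End Blocks.

Arguments block_lt {r n_}.

Section PartialFactorization.
Variables (A : comNzRingType) (f : {poly A}) (r : nat) (n_ : 'I_r -> nat).
Local Notation N := (\sum_(i < r) n_ i)%N.
Local Notation R := {mpoly A[N]}.

Definition coef_var (i : 'I_r) (j : 'I_(n_ i)) : R := 'X_(tagnat.Rank i j).
Arguments coef_var : clear implicits.

Definition generic_factor (i : 'I_r) : {poly R} :=
  'X^(n_ i) + \sum_(j < n_ i) (coef_var i j)%:P * 'X^(n_ i - j.+1)%N.

(* Over a ring, [rmodp] is the remainder of Euclidean division as soon as the
   divisor is monic, as it is here. *)
Definition PF_gen (p : R) : Prop := exists k : nat,
  p = (Pdiv.CommonRing.rmodp (map_poly (@mpolyC _ A) f)
                             (\prod_(i < r) generic_factor i))`_k.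

Definition PF_ideal : {pred R} := ideal_gen PF_gen.

Definition PF : lmodType A := ideal_quotient PF_gen.

Definition PF_class (p : R) : PF := @residue A R PF_gen p.

Definition block_ideal (i : 'I_r) : {pred R} :=
  ideal_gen (fun p => exists j, p = coef_var i j).

End PartialFactorization.

Arguments PF_ideal {A} f {r} n_.
Arguments PF {A} f {r} n_.
Arguments PF_class {A} f {r n_} p.
Arguments block_ideal A {r n_} i.

(* Main.v *)
Require Import Defs.
From HB Require Import structures.
From mathcomp Require Import all_boot all_order all_algebra.
From mathcomp Require Import mpoly.
From mathcomp Require Import fingroup perm qpoly boolp.
From mathcomp Require Import zify.

Set Implicit Arguments.
Unset Strict Implicit.
Unset Printing Implicit Defensive.

Import GRing.Theory.
Local Open Scope ring_scope.

(* Fix an order of the blocks, given by priorities, and put e_i = n minus the sum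
   of the n_k over the blocks k up to and including i.

   Existence of enough lead terms.  Modulo I, the quotient h of f by the product
   of the blocks before i is g_i K with K monic of degree e_i, and h involves only
   variables of smaller blocks.  Comparing coefficients, Toeplitz matrices formed
   from the coefficients of g_i send the vector (K_0, ..., K_{e_i} = 1) to
   coefficients of h.  By Cramer's rule, such a matrix of size e_i + 1 has modulo I
   the same determinant as the matrix with last column replaced by coefficients of
   h.  Choosing the rows according to a partition, as in the Jacobi-Trudi formula,
   this yields an element of I whose lead monomial is any prescribed monomial of
   degree e_i + 1 in the variables of block i.  Hence the standard monomials, those
   of degree at most e_i in each block i, span R/I.

   No further relations.  Let S be a ring over which f splits, built by adjoining
   one root at a time; S is free of rank n! over A.  Sending the variables of
   block i to the coefficients of the product of x - y over n_i of the roots kills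
   I, and S is spanned over the image of R by (n - N)! prod n_i! elements, where
   N is the sum of the n_i.  As the number of standard monomials times this number
   is n!, a spanning family of S of cardinality n! arises, which is therefore
   free; so the standard monomials are linearly independent modulo I. *)

(** * Monomial orders *)

Section GrevlexTheory.
Variable d : nat.
Implicit Types a b c : 'I_d -> nat.

Lemma grevlexP a b :
  reflect ((wdeg a < wdeg b)%N \/ wdeg a = wdeg b /\
             exists2 l, (b l < a l)%N & forall k : 'I_d, (l < k)%N -> b k = a k)
          (grevlex_lt a b).
Proof.
apply: (iffP orP) => -[ab|]; try by left.
  case/andP=> /eqP ab /existsP [l /andP [bal /forallP eqba]]; right; split=> //.
  by exists l => // k lk; apply/eqP; apply: (implyP (eqba k)).
case=> ab [l bal eqba]; right; rewrite ab eqxx; apply/existsP; exists l.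
by rewrite bal; apply/forallP => k; apply/implyP => /eqba ->.
Qed.

Lemma grevlex_irr a : grevlex_lt a a = false.
Proof. by apply/negP => /grevlexP [|[_ [l]]]; rewrite ltnn. Qed.

Lemma grevlex_trans b a c : grevlex_lt a b -> grevlex_lt b c -> grevlex_lt a c.
Proof.
move=> /grevlexP [ab|[ab [l bal eqba]]] /grevlexP [bc|[bc [l' cbl eqcb]]];
  apply/grevlexP; try by (left; lia).
right; split; first lia.
have [ll'|l'l|/val_inj ll'] := ltngtP l l'.
- exists l'; first by rewrite -eqba.
  by move=> k l'k; rewrite eqcb // eqba // (ltn_trans ll').
- exists l; first by rewrite eqcb.
  by move=> k lk; rewrite eqcb ?eqba // (ltn_trans l'l).
- exists l; first by rewrite (ltn_trans _ bal) // ll'.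
  by move=> k lk; rewrite eqcb ?eqba // -ll'.
Qed.

Lemma wdegD a b : wdeg (fun j => a j + b j)%N = (wdeg a + wdeg b)%N.
Proof. by rewrite /wdeg -big_split; apply: eq_bigr => j _; rewrite mulnDr. Qed.

Lemma leq_wdeg a j : (a j <= wdeg a)%N.
Proof. by rewrite /wdeg (bigD1 j) //= mulSn -addnA leq_addr. Qed.

Lemma grevlexD a b c :
  grevlex_lt a b -> grevlex_lt (fun j => a j + c j)%N (fun j => b j + c j)%N.
Proof.
move=> /grevlexP [ab|[ab [l bal eqba]]]; apply/grevlexP; rewrite !wdegD.
  by left; rewrite ltn_add2r.
right; split; first by rewrite ab.
by exists l => [|k /eqba ->]; rewrite ?ltn_add2r.
Qed.

(* Below [b] there are finitely many functions, and their number is a rank. *)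
Lemma grevlex_wf : well_founded (fun a b => grevlex_lt a b).
Proof.
move=> b; move: {2}(wdeg b) (leqnn (wdeg b)) => W.
pose under b := [pred g : {ffun 'I_d -> 'I_W.+1} | grevlex_lt (val \o g) b].
move: {2}(#|under b|) (leqnn #|under b|) => s.
elim: s b => [|s IH] b ltb leW; constructor=> a ab.
all: have leaW : (wdeg a <= W)%N by move/grevlexP: (ab) => [?|[? _]]; lia.
all: pose g : {ffun 'I_d -> 'I_W.+1} := [ffun j => inord (a j)].
all: have ga : val \o g = a
  by apply/funext=> j /=; rewrite ffunE inordK // ltnS (leq_trans (leq_wdeg a j)).
all: have gb : g \in under b by rewrite inE ga.
  by move: ltb; rewrite leqn0 => /eqP /card0_eq /(_ g); rewrite gb.
apply: IH => //; rewrite -ltnS (leq_trans _ ltb) //; apply/proper_card/properP.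
split; last by exists g => //; rewrite inE ga grevlex_irr.
by apply/subsetP=> h; rewrite !inE => /grevlex_trans; apply.
Qed.

End GrevlexTheory.

Section BlockOrder.
Variables (r : nat) (n_ : 'I_r -> nat).
Local Notation N := (\sum_(i < r) n_ i)%N.
Implicit Types (m u : 'X_{1..N}) (i k : 'I_r).

Lemma blockD m u i : @block _ n_ (m + u) i =
  (fun j => @block _ n_ m i j + @block _ n_ u i j)%N.
Proof. by apply/funext=> j; rewrite /block mnmDE. Qed.

Lemma bdegD m u i : @bdeg _ n_ (m + u) i = (bdeg m i + bdeg u i)%N.
Proof. by rewrite /bdeg blockD -big_split. Qed.

(* Both orders of the blocks are needed: assertion 3 concerns the basis attached
   to the reverse of the order of assertion 2. *)
Variable pri : 'I_r -> nat.

Definition prec m m' : Prop := exists2 i,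
  grevlex_lt (@block _ n_ m i) (@block _ n_ m' i) &
  forall k, (pri i < pri k)%N -> @block _ n_ m k = @block _ n_ m' k.

Lemma prec_irr m : ~ prec m m.
Proof. by case=> i; rewrite grevlex_irr. Qed.

Lemma precD u m m' : prec m m' -> prec (m + u)%MM (m' + u)%MM.
Proof.
case=> i lt_i eq_k; exists i; first by rewrite !blockD grevlexD.
by move=> k /eq_k eqk; rewrite !blockD eqk.
Qed.

Hypothesis pri_inj : injective pri.

Lemma prec_trans m2 m1 m3 : prec m1 m2 -> prec m2 m3 -> prec m1 m3.
Proof.
case=> i lt_i eq_i [k lt_k eq_k].
have [ik|ki|/pri_inj ik] := ltngtP (pri i) (pri k).
- exists k; first by rewrite eq_i.
  by move=> l kl; rewrite eq_i ?eq_k // (ltn_trans ik).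
- exists i; first by rewrite -eq_k.
  by move=> l il; rewrite eq_i ?eq_k // (ltn_trans ki).
- rewrite ik in lt_i eq_i; exists k; first exact: grevlex_trans lt_k.
  by move=> l kl; rewrite eq_i ?eq_k.
Qed.

Lemma prec_wf : well_founded prec.
Proof.
(* Restricting the deciding block to priorities below [t] gives an induction. *)
pose R t m m' := exists2 i, (pri i < t)%N /\ 
  grevlex_lt (@block _ n_ m i) (@block _ n_ m' i) &
  forall k, (pri i < pri k)%N -> @block _ n_ m k = @block _ n_ m' k.
suff wfR t : well_founded (R t).
  have [t ltt] : exists t, forall i, (pri i < t)%N.
    by exists (\max_i pri i).+1 => i; rewrite ltnS leq_bigmax.
  move=> m; elim: (wfR t m) => {}m _ IH; constructor=> m' [i lt_i eq_i].
  by apply: IH; exists i.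
elim: t => [|t IHt] m; first by constructor=> m' [i []].
have [/existsP [i0 /eqP it]|] := boolP [exists i, pri i == t]; last first.
  move=> /existsPn nt; elim: (IHt m) => {}m _ IH; constructor=> m' [i [it lt_i] eq_i].
  by apply: IH; exists i => //; split=> //; rewrite ltn_neqAle (nt i) -ltnS.
(* Nested induction: the outer one follows [grevlex_lt] on the block [i0] of priority [t], the inner
   one follows [R t]. A descent decided in [i0] lowers that block; a descent decided at smaller
   priority leaves it unchanged. *)
move: {2}(@block _ n_ m i0) (erefl (@block _ n_ m i0)) => b.
elim: (grevlex_wf b) m => {}b _ IHb m.
elim: (IHt m) => {}m _ IHm mb.
constructor=> m' [i [it' lt_i] eq_i].
have [ii0|nii0] := eqVneq i i0.
  by apply: IHb (erefl _); rewrite -mb -ii0.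
have itt : (pri i < t)%N.
  rewrite ltn_neqAle -ltnS it' andbT; apply: contraNneq nii0 => ht.
  by apply/eqP/pri_inj; rewrite ht it.
by apply: IHm; [exists i | rewrite eq_i ?it].
Qed.

End BlockOrder.

Lemma block_ltP (r : nat) (n_ : 'I_r -> nat) (m m' : 'X_{1.. \sum_(i < r) n_ i}) :
  reflect (prec (@nat_of_ord r) m m') (@block_lt r n_ m m').
Proof.
apply: (iffP existsP) => -[i].
  move=> /andP [lt_i /forallP eq_k]; exists i => // k ik; apply/funext => j.
  by move/implyP: (eq_k k) => /(_ ik) /forallP /(_ j) /eqP.
move=> lt_i eq_k; exists i; rewrite lt_i; apply/forallP => k; apply/implyP => ik.
by apply/forallP => j; rewrite eq_k.
Qed.

(** * Division by monic polynomials *)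

Section MonicDivision.
Variable R : comNzRingType.
Implicit Types (p q u G : {poly R}) (Z : R -> Prop).

Definition coefs_in Z p := forall k, Z p`_k.

(** Weak enough to cover subrings, ideals and the zero ideal; division by a monic polynomial is
    applied below with all three. *)
Definition additive_subgroup Z := Z 0 /\ forall a b, Z a -> Z b -> Z (a - b).

Lemma additive_subgroup_add Z a b :
  additive_subgroup Z -> Z a -> Z b -> Z (a + b).
Proof.
by case=> Z0 ZB Za Zb; rewrite -[b]opprK -[- b]sub0r; apply: (ZB) => //; apply: ZB.
Qed.

Lemma additive_subgroup_sum Z (I : Type) (s : seq I) (P : pred I) (F : I -> R) :
  additive_subgroup Z -> (forall i, P i -> Z (F i)) -> Z (\sum_(i <- s | P i) F i).
Proof.
by move=> ZP ZF; elim/big_ind: _ => // [|a b]; [case: ZP|apply: additive_subgroup_add].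
Qed.

(* The coefficients of [u] are recovered from the top, where [q] is invisible. *)
Lemma monic_quotient_coefs Z G u q :
    additive_subgroup Z -> (forall a k, Z a -> Z (a * G`_k)) -> G \is monic ->
    (size q < size G)%N -> coefs_in Z (G * u + q) -> coefs_in Z u.
Proof.
move=> ZP ZG Gm; move: {2}(size u) (leqnn (size u)) => s.
elim: s u q => [|s IH] u q.
  by rewrite leqn0 size_poly_eq0 => /eqP -> _ _ k; rewrite coef0; case: ZP.
move=> us qG ZGu.
have [g Gs] : exists g, size G = g.+1.
  by exists (size G).-1; rewrite prednK // (leq_trans _ qG).
have Gg : G`_g = 1 by rewrite -(monicP Gm) /lead_coef Gs.
rewrite Gs ltnS in qG.
have Ztop : Z u`_s.
  have := ZGu (g + s)%N; rewrite coefD [q`__]nth_default; last first.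
    by rewrite (leq_trans qG) ?leq_addr.
  rewrite addr0 coefM (bigD1 (inord g)) //= inordK ?ltnS ?leq_addr //.
  rewrite addKn Gg mul1r big1 ?addr0 // => i.
  rewrite -val_eqE /= inordK ?ltnS ?leq_addr // => neq_i.
  case: (ltnP i g) => [ilt|ige].
    by rewrite [u`__]nth_default ?mulr0 // (leq_trans us) //; lia.
  by rewrite [G`__]nth_default ?mul0r // Gs; lia.
pose u' := u - u`_s *: 'X^s.
have u'E : u = u' + u`_s *: 'X^s by rewrite subrK.
have Zu' : coefs_in Z u'.
  apply: (IH _ q); last 1 first.
  - move=> k; have -> : G * u' + q = (G * u + q) - u`_s *: (G * 'X^s).
      by rewrite mulrBr scalerAr addrAC.
    rewrite coefB coefZ coefMXn; apply: (proj2 ZP) => //.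
    by case: ifP => _; [rewrite mulr0; case: ZP | apply: ZG].
  - apply/leq_sizeP => j sj; rewrite coefB coefZ coefXn.
    have [->|neq_j] := eqVneq j s; first by rewrite mulr1 subrr.
    by rewrite mulr0 subr0 nth_default // (leq_trans us) //; lia.
  - by rewrite Gs.
move=> k; rewrite u'E coefD coefZ coefXn; apply: additive_subgroup_add => //.
by case: (k == s); rewrite ?mulr1 // mulr0; case: ZP.
Qed.

Definition subring Z := [/\ Z 1, forall a b, Z a -> Z b -> Z (a - b)
  & forall a b, Z a -> Z b -> Z (a * b)].

Lemma subring_additive Z : subring Z -> additive_subgroup Z.
Proof. by case=> Z1 ZB _; split=> //; rewrite -(subrr 1); apply: ZB. Qed.

Lemma coefs_in_sub Z p q : additive_subgroup Z ->
  coefs_in Z p -> coefs_in Z q -> coefs_in Z (p - q).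
Proof. by move=> [_ ZB] Zp Zq k; rewrite coefB; apply: ZB. Qed.

Lemma coefs_in_mul Z p q : subring Z ->
  coefs_in Z p -> coefs_in Z q -> coefs_in Z (p * q).
Proof.
move=> ZP Zp Zq k; rewrite coefM; apply: additive_subgroup_sum => [|i _].
  exact: subring_additive.
by case: ZP => _ _; apply.
Qed.

Lemma coefs_in_prod Z (I : Type) (s : seq I) (P : pred I) (F : I -> {poly R}) :
    subring Z -> (forall i, P i -> coefs_in Z (F i)) ->
  coefs_in Z (\prod_(i <- s | P i) F i).
Proof.
move=> ZP ZF; elim/big_ind: _ => //; last by move=> p q; apply: coefs_in_mul.
by move=> k; rewrite coef1; case: (k == 0)%N; [case: ZP|case: (subring_additive ZP)].
Qed.

Lemma subring_sum Z (I : Type) (s : seq I) (P : pred I) (F : I -> R) :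
  subring Z -> (forall i, P i -> Z (F i)) -> Z (\sum_(i <- s | P i) F i).
Proof. by move/subring_additive; apply: additive_subgroup_sum. Qed.

Lemma monic_dvd_coefs Z G u q : subring Z -> G \is monic -> coefs_in Z G ->
  (size q < size G)%N -> coefs_in Z (G * u + q) -> coefs_in Z u.
Proof.
move=> ZP Gm ZG; apply: monic_quotient_coefs => //; first exact: subring_additive.
by move=> a k Za; case: ZP => _ _; apply.
Qed.

Definition monic_deg p (d : nat) := (p \is monic) && (size p == d.+1).

Lemma monic_degM p q d e : monic_deg p d -> monic_deg q e -> monic_deg (p * q) (d + e).
Proof.
move=> /andP [pm /eqP ps] /andP [qm /eqP qs]; rewrite /monic_deg monicMl // qm /=.
by rewrite size_monicM ?monic_neq0 // ps qs addSn addnS.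
Qed.

Lemma monic_deg_prod (I : Type) (s : seq I) (P : pred I) (F : I -> {poly R})
    (d : I -> nat) : (forall i, P i -> monic_deg (F i) (d i)) ->
  monic_deg (\prod_(i <- s | P i) F i) (\sum_(i <- s | P i) d i).
Proof.
move=> F_monic; elim/big_rec2: _ => [|i e p Pi].
  by rewrite /monic_deg monic1 size_poly1 eqxx.
by apply: monic_degM; apply: F_monic.
Qed.

(** Since [q] lies below the degree of [G], it does not touch the lead term of [G * u], and [u]
    inherits that lead coefficient. *)
Lemma monic_deg_quotient G u q d e : monic_deg G d -> (size q < size G)%N ->
  monic_deg (G * u + q) (d + e) -> monic_deg u e.
Proof.
move=> /andP [Gm /eqP Gs] qG /andP [fm /eqP fs].
have u0 : u != 0.
  apply: contraTneq qG => u0; move: fs; rewrite u0 mulr0 add0r => ->.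
  by rewrite Gs -leqNgt ltnS leq_addr.
have sGu : size (G * u) = (d + size u)%N by rewrite size_monicM // Gs.
have lt : (size q < size (G * u)%R)%N.
  by rewrite sGu; apply: leq_trans qG _; rewrite Gs -addn1 leq_add2l lt0n size_poly_eq0.
move: fs fm; rewrite size_polyDl // => fs; rewrite monicE lead_coefDl //.
rewrite lead_coef_monicM // => um; rewrite /monic_deg monicE um /=.
by rewrite sGu -addnS in fs; rewrite -(eqn_add2l d) fs.
Qed.

End MonicDivision.

Lemma ideal_gen_mem (R : comNzRingType) (S : R -> Prop) p : S p -> p \in ideal_gen S.
Proof.
move=> Sp; apply/asboolP; exists 1%N, (fun=> 1), (fun=> p); split=> //.
by rewrite big_ord1 mul1r.
Qed.

(** * Polynomials with restricted support *)

Section Support.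
Variables (A : comNzRingType) (N : nat).
Implicit Types (p q : {mpoly A[N]}) (U V : 'X_{1..N} -> Prop) (m u : 'X_{1..N}).

Definition supported U p := forall m, m \in msupp p -> U m.

Lemma supportedW U V p : (forall m, U m -> V m) -> supported U p -> supported V p.
Proof. by move=> UV Up m /Up /UV. Qed.

Lemma supported0 U : supported U 0.
Proof. by move=> m; rewrite msupp0. Qed.

Lemma supportedD U p q : supported U p -> supported U q -> supported U (p + q).
Proof. by move=> Up Uq m /msuppD_le; rewrite mem_cat => /orP [/Up|/Uq]. Qed.

Lemma supportedB U p q : supported U p -> supported U q -> supported U (p - q).
Proof. by move=> Up Uq m /msuppB_le; rewrite mem_cat => /orP [/Up|/Uq]. Qed.

Lemma supportedN U p : supported U p -> supported U (- p).
Proof. by rewrite -[- p]sub0r; apply: supportedB; apply: supported0. Qed.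

Lemma supportedZ U a p : supported U p -> supported U (a *: p).
Proof. by move=> Up m /msuppZ_le /Up. Qed.

Lemma supported_sum U (I : Type) (s : seq I) (P : pred I) (F : I -> {mpoly A[N]}) :
  (forall i, P i -> supported U (F i)) -> supported U (\sum_(i <- s | P i) F i).
Proof.
by move=> UF; apply: big_ind; [exact: supported0|exact: supportedD|exact: UF].
Qed.

Lemma supportedX U m : U m -> supported U 'X_[m].
Proof. by move=> Um m'; rewrite msuppX inE => /eqP ->. Qed.

Lemma supported1 U : U 0%MM -> supported U 1.
Proof. by rewrite -mpolyX0; apply: supportedX. Qed.

Lemma supportedC U a : U 0%MM -> supported U a%:MP.
Proof.
by move=> U0; rewrite -[a%:MP]mulr1 mul_mpolyC; apply: supportedZ; apply: supported1.
Qed.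

Lemma supportedM U V W p q : (forall m u, U m -> V u -> W (m + u)%MM) ->
  supported U p -> supported V q -> supported W (p * q).
Proof.
move=> UVW Up Vq m /msuppM_le /allpairsP [[m1 m2] /= [/Up Um1 /Vq Vm2 ->]].
exact: UVW.
Qed.

(** The weight of the factor [i] is compared with [b i - a i], which may be negative; keeping [a i]
    on the left avoids subtraction. The relation [P] is equality for homogeneous determinants, [leq]
    when one column loses weight, and the reverse inequality for powers of block ideals. *)
Lemma supported_weight_prod (wt : 'X_{1..N} -> nat) U (P : nat -> nat -> Prop)
    (I : Type) (s : seq I) (F : I -> {mpoly A[N]}) (a b : I -> nat) :
    P 0 0 -> (forall x y z t, P x y -> P z t -> P (x + z) (y + t))%N ->
    wt 0%MM = 0%N -> (forall m u, wt (m + u)%MM = wt m + wt u)%N ->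
    U 0%MM -> (forall m u, U m -> U u -> U (m + u)%MM) ->
    (forall i, supported (fun m => P (wt m + a i)%N (b i) /\ U m) (F i)) ->
  supported (fun m => P (wt m + \sum_(i <- s) a i)%N (\sum_(i <- s) b i)%N /\ U m)
    (\prod_(i <- s) F i).
Proof.
move=> P0 PD wt0 wtD U0 UD Fab; elim: s => [|i s IH].
  by rewrite !big_nil; apply: supported1; rewrite wt0.
rewrite !big_cons; apply: (supportedM _ (Fab i) IH) => m u [mab Um] [uab Uu].
by split; [rewrite wtD addnACA; apply: PD | apply: UD].
Qed.

Lemma monomial_combination U p : supported U p ->
  p \in ideal_gen (fun t => exists2 m, U m & t = 'X_[A, m]).
Proof.
move=> Up; rewrite [p]mpolyE big_seq; apply: rpred_sum => m /Up Um.
rewrite -mul_mpolyC; apply: ideal_gen_mull; apply/asboolP.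
exists 1%N, (fun=> 1), (fun=> 'X_[m]); split=> [_|]; last by rewrite big_ord1 mul1r.
by exists m.
Qed.

(** As [U] is stable under multiplication by monomials, membership in the monomial ideal can be
    tested on each monomial of [p] separately. *)
Lemma ideal_gen_monomialsP U p : (forall m u, U m -> U (u + m)%MM) ->
  p \in ideal_gen (fun t => exists2 m, U m & t = 'X_[A, m]) <-> supported U p.
Proof.
move=> Uup; split; last exact: monomial_combination.
case/asboolP=> k [a [s [Us ->]]]; apply: supported_sum => i _.
have [m Um ->] := Us i.
by apply: (@supportedM (fun=> True) U) => //; [move=> u v _; apply: Uup|apply: supportedX].
Qed.

End Support.

(** * Elements of the ideal with prescribed lead monomial *)

(** Cramer's rule with an error term: the two determinants differ by a combination of the entries of
    [M q - v], so they agree modulo any ideal containing these entries. Both matrices have the same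
    cofactors along column [c]. *)
Lemma det_replace_col (R : comNzRingType) (e : nat) (M : 'M[R]_e)
    (q v : 'I_e -> R) (c : 'I_e) : q c = 1 ->
  \det M - \det (\matrix_(k, l) if l == c then v k else M k l) =
  \sum_k (\sum_l M k l * q l - v k) * cofactor M k c.
Proof.
move=> qc; set M' := \matrix_(_, _) _.
have cofE k : cofactor M' k c = cofactor M k c.
  congr (_ * \det _); apply/matrixP => a b; rewrite !mxE.
  by rewrite eq_sym (negbTE (neq_lift c b)).
rewrite (expand_det_col M' c).
under [X in _ - X]eq_bigr => k _ do rewrite cofE mxE eqxx.
under [RHS]eq_bigr => k _ do rewrite mulrBl.
rewrite sumrB; congr (_ - _).
under eq_bigr => k _ do rewrite mulr_suml.
rewrite exchange_big /= (bigD1 c) //= [X in _ + X]big1 ?addr0 => [|l lc].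
  by rewrite (expand_det_col M c); apply: eq_bigr => k _; rewrite qc mulr1.
(* The coefficient of [q l] is the entry [(c, l)] of the adjugate times [M], which vanishes off the
   diagonal. *)
have := congr1 (fun X : 'M_e => X c l) (mul_adj_mx M).
rewrite !mxE eq_sym (negbTE lc) mulr0n => adj0.
  rewrite -[RHS](mulr0 (q l)) -[in RHS]adj0 mulr_sumr; apply: eq_bigr => k _.
by rewrite mxE mulrAC mulrC [M k l * _]mulrC.
Qed.

Section GenericFactor.
Variables (A : comNzRingType) (r : nat) (n_ : 'I_r -> nat).
Local Notation N := (\sum_(i < r) n_ i)%N.
Local Notation g := (@generic_factor A r n_).

Lemma coef_generic_factor i (j : 'I_(n_ i)) :
  (g i)`_(n_ i - j.+1) = 'X_(tagnat.Rank i j).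
Proof.
rewrite /generic_factor coefD coefXn coef_sum (_ : _ == _ = false); last first.
  by have := ltn_ord j; lia.
rewrite add0r (bigD1 j) //= coefCM coefXn eqxx mulr1 [X in _ + X]big1 => [|k kj].
  exact: addr0.
rewrite coefCM coefXn (_ : _ == _ = false) ?mulr0 //.
move: kj; rewrite -val_eqE /=; have := ltn_ord j; have := ltn_ord k; lia.
Qed.

Lemma generic_factor_monic i : monic_deg (g i) (n_ i).
Proof.
have small :
    (size (\sum_(j < n_ i) (@coef_var A r n_ i j)%:P * 'X^(n_ i - j.+1)%N)%R <= n_ i)%N.
  apply: (leq_trans (size_sum _ _ _)); apply/bigmax_leqP => j _.
  rewrite mul_polyC (leq_trans (size_scale_leq _ _)) // size_polyXn.
  by have := ltn_ord j; lia.
rewrite /monic_deg /generic_factor monicE lead_coefDl ?size_polyXn ?ltnS //.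
by rewrite lead_coefXn eqxx size_polyDl size_polyXn ?eqxx ?ltnS.
Qed.

Lemma coef_generic_factor_top i : (g i)`_(n_ i) = 1.
Proof.
by have /andP [/monicP gm /eqP gs] := generic_factor_monic i; rewrite -gm /lead_coef gs.
Qed.

Variant generic_coef_spec i (u : nat) : {mpoly A[N]} -> Type :=
| GenericCoefZero of (n_ i < u)%N : generic_coef_spec i u 0
| GenericCoefOne of u = n_ i : generic_coef_spec i u 1
| GenericCoefVar (j : 'I_(n_ i)) of (u + j.+1 = n_ i)%N :
    generic_coef_spec i u 'X_(tagnat.Rank i j).

Lemma generic_coefP i u : generic_coef_spec i u (g i)`_u.
Proof.
have [un|nu|->] := ltngtP u (n_ i).
- have jP : (n_ i - u.+1 < n_ i)%N by lia.
  pose j := Ordinal jP.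
  have E : (u + j.+1 = n_ i)%N by rewrite /=; lia.
  have {2}-> : u = (n_ i - j.+1)%N by lia.
  by rewrite coef_generic_factor; apply: GenericCoefVar.
- have /andP [_ /eqP gs] := generic_factor_monic i.
  by rewrite nth_default ?gs //; apply: GenericCoefZero.
- by rewrite coef_generic_factor_top; apply: GenericCoefOne.
Qed.

End GenericFactor.

(** At the largest index where [a] exceeds [b], domination and maximality force equality beyond it.
    The deciding index of the order thus need not be known in advance. *)
Lemma grevlex_dominance (d : nat) (a b : 'I_d -> nat) (l0 : 'I_d) :
    wdeg a = wdeg b -> (b l0 < a l0)%N ->
    (forall k : 'I_d, (l0 < k)%N -> (b k <= a k)%N) ->
  grevlex_lt a b.
Proof.
move=> wab bal0 le_ba; apply/grevlexP; right; split=> //.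
case: (@arg_maxnP _ l0 (fun l => b l < a l)%N (fun l => l : nat) bal0) => l bal maxl.
exists l => // k lk; have := maxl l0 bal0 => l0l.
apply/eqP; rewrite eqn_leq le_ba ?(leq_ltn_trans l0l) //= leqNgt.
by apply/negP => /maxl /=; lia.
Qed.

Section LeadingElements.
Variables (A : comNzRingType) (f : {poly A}) (n r : nat) (n_ : 'I_r -> nat).
Hypotheses (f_monic : f \is monic) (f_deg : size f = n.+1).
Hypothesis n_le : (\sum_(i < r) n_ i <= n)%N.
Variable pri : 'I_r -> nat.
Hypothesis pri_inj : injective pri.

Local Notation N := (\sum_(i < r) n_ i)%N.
Local Notation R := {mpoly A[N]}.
Local Notation g := (@generic_factor A r n_).
Local Notation I := (PF_ideal f n_).
Local Notation fR := (map_poly (@mpolyC N A) f).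
Local Notation blk m i := (@block r n_ m i).

Lemma mapC_monic : monic_deg fR n.
Proof.
rewrite /monic_deg monic_map // size_map_poly_id0 ?f_deg ?eqxx //.
by rewrite (monicP f_monic) rmorph1 oner_neq0.
Qed.

Lemma ideal_subgroup : additive_subgroup (fun p : R => p \in I).
Proof. by split=> [|a b]; [exact: rpred0 | exact: rpredB]. Qed.

Lemma subring_supported (U : 'X_{1..N} -> Prop) : U 0%MM ->
  (forall m u, U m -> U u -> U (m + u)%MM) -> subring (@supported A N U).
Proof.
move=> U0 UD; split; [exact: supported1 | by move=> *; apply: supportedB|].
by move=> a b; apply: supportedM.
Qed.

Section Block.
Variable i : 'I_r.
Local Notation d := (n_ i).
Local Notation e := (n - \sum_(k < r | (pri k <= pri i)%N) n_ k)%N.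

Definition below (m : 'X_{1..N}) := forall k, (pri i <= pri k)%N -> blk m k = fun=> 0%N.

Lemma sum_pri_split : (\sum_(k < r | pri k <= pri i) n_ k =
  \sum_(k < r | pri k < pri i) n_ k + n_ i)%N.
Proof.
rewrite (bigD1 i) //= addnC; congr (_ + _)%N; apply: eq_bigl => k.
by rewrite ltn_neqAle andbC (inj_eq pri_inj).
Qed.

Lemma sum_pri_le (P : pred 'I_r) : (\sum_(k | P k) n_ k <= n)%N.
Proof. by rewrite (leq_trans _ n_le) // [leqRHS](bigID P) leq_addr. Qed.

(* Modulo [I], the product of the factors preceding [g i] divides [f] with
   quotient [h], and [g i] divides [h]; cancelling monic factors is legitimate. *)
Lemma quotient_congruence : exists K h : {poly R},
  [/\ monic_deg K e, coefs_in (@supported A N below) h &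
      coefs_in (fun p => p \in I) (g i * K - h)].
Proof.
pose G := \prod_(k < r) g k.
pose G1 := \prod_(k < r | (pri k < pri i)%N) g k.
pose G2 := \prod_(k < r | (pri i < pri k)%N) g k.
have GE : G = G1 * (g i * G2).
  rewrite /G [LHS](bigID (fun k => pri k < pri i)%N) /=; congr (_ * _).
  rewrite [LHS](bigD1 i) ?ltnn //=; congr (_ * _); apply: eq_bigl => k.
  by rewrite -leqNgt ltn_neqAle eq_sym (inj_eq pri_inj) andbC eq_sym.
have mon P : monic_deg (\prod_(k < r | P k) g k) (\sum_(k < r | P k) n_ k).
  by apply: monic_deg_prod => k _; apply: generic_factor_monic.
have /andP [Gm _] := mon xpredT; have /andP [G1m _] := mon (fun k => pri k < pri i)%N.
pose Q := Pdiv.CommonRing.rdivp fR G; pose rem := Pdiv.CommonRing.rmodp fR G.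
pose h := Pdiv.CommonRing.rdivp fR G1; pose rem1 := Pdiv.CommonRing.rmodp fR G1.
have fQ : fR = G * Q + rem by rewrite [in LHS](Pdiv.RingMonic.rdivp_eq Gm fR) mulrC.
have fh : fR = G1 * h + rem1 by rewrite [in LHS](Pdiv.RingMonic.rdivp_eq G1m fR) mulrC.
have rem_lt : (size rem < size G)%N by rewrite Pdiv.CommonRing.ltn_rmodp (monic_neq0 Gm).
have rem1_lt : (size rem1 < size G1)%N.
  by rewrite Pdiv.CommonRing.ltn_rmodp (monic_neq0 G1m).
have rem_I : coefs_in (fun p => p \in I) rem.
  by move=> k; apply: ideal_gen_mem; exists k.
exists (G2 * Q), h; split.
- have Qm : monic_deg Q (n - N).
    by apply: (monic_deg_quotient (mon xpredT) rem_lt); rewrite -fQ subnKC // mapC_monic.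
  suff -> : e = (\sum_(k < r | pri i < pri k) n_ k + (n - N))%N.
    by apply: monic_degM Qm; apply: mon.
  suff NE : N = (\sum_(k < r | pri k <= pri i) n_ k +
                 \sum_(k < r | pri i < pri k) n_ k)%N by lia.
  rewrite (bigID (fun k => pri k <= pri i)%N) /=; congr (_ + _)%N.
  by apply: eq_bigl => k; rewrite ltnNge.
(* The coefficients of [fR] are constants and those of [G1] involve only earlier blocks; division by
   a monic polynomial stays in this subring. *)
- apply: (@monic_dvd_coefs _ _ G1 h rem1) => //.
  + by apply: subring_supported => [k _|m u mb ub k ik];
      apply/funext=> j; rewrite ?blockD ?mb ?ub // /block mnm0E.
  + apply: coefs_in_prod => [|k ki u].
      by apply: subring_supported => [l _|m u mb ub l il];
        apply/funext=> j; rewrite ?blockD ?mb ?ub // /block mnm0E.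
    case: generic_coefP => [||j] *; first exact: supported0.
      by apply: supported1 => l _; apply/funext=> j; rewrite /block mnm0E.
    apply: supportedX => l il; apply/funext=> j'; rewrite /block mnm1E.
    apply/eqP; rewrite eqb0 -val_eqE tagnat.eq_Rank negb_and.
    by apply/orP; left; apply: contraTneq ki => ->; rewrite -leqNgt.
  + rewrite -fh => k; rewrite coef_map; apply: supportedC => l _.
    by apply/funext=> j; rewrite /block mnm0E.
- have stable (a : R) (G0 : {poly R}) k : a \in I -> a * G0`_k \in I.
    by move=> aI; rewrite mulrC; apply: ideal_gen_mull.
  apply: (@monic_quotient_coefs _ _ G1 _ (- rem1) ideal_subgroup) => //.
  + by move=> a k; apply: stable.
  + by rewrite size_polyN.
  (* Both divisions have the same dividend [fR]; what remains is [- rem], and the coefficients of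
     [rem] are the generators of the ideal. *)
  + have -> : G1 * (g i * (G2 * Q) - h) - rem1 = - rem.
      have -> : G1 * (g i * (G2 * Q) - h) = G * Q - G1 * h by rewrite GE mulrBr !mulrA.
      by rewrite -addrA -opprD -fh fQ opprD addNKr.
    by move=> k; rewrite coefN rpredN.
Qed.


(** * Jacobi-Trudi determinants with prescribed lead monomial *)

Section Determinant.
Variable lam : 'I_e.+1 -> 'I_d.
Hypothesis lam_dec : forall k k' : 'I_e.+1, (k <= k')%N -> (lam k' <= lam k)%N.

Let wt (m : 'X_{1..N}) := wdeg (blk m i).
Let U (m : 'X_{1..N}) := forall k, (pri i < pri k)%N -> blk m k = fun=> 0%N.
(** The numbers [(lam k).+1] are the parts of a partition, and [m0] is the product of the
    corresponding variables of block [i], of degree [e.+1]. *)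
Let m0 : 'X_{1..N} := (\sum_k U_(tagnat.Rank i (lam k)))%MM.
(* Up to a choice of rows this is multiplication by [g i] on polynomials of degree
   at most [e]: it sends the coefficients of [K] to coefficients of [g i * K]. *)
Let M : 'M[R]_e.+1 := \matrix_(k, l) (g i * 'X^l)`_(d + k - (lam k).+1).

Lemma block0 k : blk 0%MM k = fun=> 0%N.
Proof. by apply/funext => j; rewrite /block mnm0E. Qed.

Lemma block_var j k (l : 'I_(n_ k)) :
  blk U_(tagnat.Rank i j) k l = (i == k) && (j == l :> nat).
Proof. by rewrite /block mnm1E -val_eqE tagnat.eq_Rank. Qed.

Let wt0 : wt 0%MM = 0%N.
Proof. by rewrite /wt block0 /wdeg big1 // => j _; rewrite muln0. Qed.

Let wtD m u : (wt (m + u)%MM = wt m + wt u)%N.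
Proof. by rewrite /wt blockD wdegD. Qed.

Let wt_var j : wt U_(tagnat.Rank i j) = j.+1.
Proof.
rewrite /wt /wdeg (bigD1 j) //= block_var !eqxx muln1 big1 ?addn0 // => l lj.
by rewrite block_var eqxx val_eqE eq_sym (negbTE lj) muln0.
Qed.

Let U0 : U 0%MM.
Proof. by move=> k _; rewrite block0. Qed.

Let UD m u : U m -> U u -> U (m + u)%MM.
Proof. by move=> Um Uu k ik; apply/funext=> j; rewrite blockD Um ?Uu. Qed.

Let U_var j : U U_(tagnat.Rank i j).
Proof.
move=> k ik; apply/funext=> l; rewrite block_var; case: eqVneq => // ik'.
by rewrite ik' ltnn in ik.
Qed.

Let entryE (k l : 'I_e.+1) : M k l = 0 \/
  exists2 u, (u + l + (lam k).+1 = d + k)%N & M k l = (g i)`_u.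
Proof.
rewrite mxE coefMXn; case: ltnP => lk; [by left | right].
exists (d + k - (lam k).+1 - l)%N => //; have := ltn_ord (lam k); lia.
Qed.

(** With [c_0 = 1] and [c_t = 0] for [t] outside [0..d], the entry is [c_t] for
    [t = (lam k).+1 + l - k], the shape of Jacobi-Trudi. Summed over a permutation, the shifts
    [l - k] cancel, so every term of the determinant has the weight of [m0]. *)
Let entry_supp (k l : 'I_e.+1) :
  supported (fun m => (wt m + k = (lam k).+1 + l)%N /\ U m) (M k l).
Proof.
have [->|[u ul ->]] := entryE k l; first exact: supported0.
case: generic_coefP => [ud|ud|j uj]; first exact: supported0.
  by apply: supported1; rewrite wt0; split=> //; lia.
by apply: supportedX; rewrite wt_var; split=> //; lia.
Qed.

Let entry_diag k : M k k = 'X_(tagnat.Rank i (lam k)).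
Proof.
rewrite mxE coefMXn ifF; last by have := ltn_ord (lam k); lia.
by rewrite -coef_generic_factor; congr (_`_ _); have := ltn_ord (lam k); lia.
Qed.

Let entry_above (k l : 'I_e.+1) : (k < l)%N ->
  supported (fun m => exists2 v : 'I_d, (lam k < v)%N & m = U_(tagnat.Rank i v)%MM)
    (M k l).
Proof.
move=> kl; have [->|[u ul ->]] := entryE k l; first exact: supported0.
case: generic_coefP => [ud|ud|j uj]; first exact: supported0; first lia.
by apply: supportedX; exists j => //; lia.
Qed.

Let m0E j : blk m0 i j = (\sum_k (lam k == j))%N.
Proof.
rewrite /block mnm_sumE; apply: eq_bigr => k _.
by have := @block_var (lam k) i j; rewrite /block eqxx => ->.
Qed.

Let U_m0 : U m0.
Proof. by apply: (big_ind U) => // k _; apply: U_var. Qed.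

Let wt_m0 : wt m0 = (\sum_k (lam k).+1)%N.
Proof.
rewrite /m0 (big_morph wt wtD wt0); apply: eq_bigr => k _; exact: wt_var.
Qed.

Let prec_low m : U m -> grevlex_lt (blk m i) (blk m0 i) -> prec pri m m0.
Proof. by move=> Um lt_m; exists i => // k ik; rewrite Um // U_m0. Qed.

(** Let [k0] be the first row moved by [s]. The rows before it contribute their diagonal variables,
    and row [k0] contributes a variable [v] with [v > lam k0]. As [lam] is nonincreasing, exponents
    of [m0] beyond [lam k0] come only from the rows before [k0]. So a monomial of the term dominates
    [m0] there, strictly at [v], and with equal weight this makes it smaller. *)
Let det_term (s : {perm 'I_e.+1}) : s != 1%g ->
  supported (fun m => prec pri m m0) (\prod_k M k (s k)).
Proof.
move=> s1; have [k1 sk1] : exists k, s k != k.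
  apply/existsP; apply: contraNT s1 => /existsPn sid.
  by apply/eqP/permP => k; rewrite perm1; apply/eqP; rewrite -[_ == _]negbK.
case: (@arg_minnP _ k1 (fun k => s k != k) (fun k => k : nat) sk1) => k0 sk0 mink0.
have sid (k : 'I_e.+1) : (k < k0)%N -> s k = k.
  by move=> kk0; apply/eqP; apply: contraLR kk0 => /mink0; rewrite -leqNgt.
(* All smaller rows are fixed, so by injectivity [s] cannot send [k0] below itself. *)
have k0s : (k0 < s k0)%N.
  rewrite ltn_neqAle eq_sym sk0 leqNgt /=; apply: contra sk0 => /sid /perm_inj ->.
  by [].
pose V m := exists2 v : 'I_d, (lam k0 < v)%N &
  forall j, (\sum_(k < e.+1 | (k < k0)%N) (lam k == j) + (v == j) <= blk m i j)%N.
pose u1 : 'X_{1..N} := (\sum_(k < e.+1 | (k < k0)%N) U_(tagnat.Rank i (lam k)))%MM.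
have VP : supported V (\prod_k M k (s k)).
  rewrite [X in supported _ X](bigD1 k0) //=.
  rewrite [X in _ * X](bigID (fun k : 'I_e.+1 => k < k0)%N) /=.
  rewrite [X in _ * (X * _)](_ : _ = 'X_[u1]); last first.
    rewrite /u1 -mprodXE; apply: eq_big => [k|k /andP [_ kk0]].
      by rewrite -val_eqE; case: ltngtP.
    by rewrite sid // entry_diag.
  have u1_supp : supported (fun m => exists u, m = (u1 + u)%MM)
      ('X_[u1] * \prod_(k | (k != k0) && ~~ (k < k0)%N) M k (s k)).
    apply: (@supportedM _ _ (eq u1) (fun=> True)) => //.
      by move=> _ u <- _; exists u.
    exact: supportedX.
  apply: (supportedM _ (entry_above k0s) u1_supp).
  move=> _ _ [v kv ->] [u ->]; exists v => // j.
  rewrite !blockD block_var eqxx val_eqE /= addnC leq_add2l.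
  rewrite (leq_trans _ (leq_addr _ _)) // /block mnm_sumE leq_sum // => k _.
  by have := @block_var (lam k) i j; rewrite /block eqxx => ->.
have WP : supported (fun m => (wt m + \sum_(k < e.+1) k)%N =
    (\sum_(k < e.+1) ((lam k).+1 + s k))%N /\ U m) (\prod_k M k (s k)).
  apply: (@supported_weight_prod A N wt U eq _ _ _ _ _ _ _ wt0 wtD U0 UD)
    => [//|x y z t -> -> //|k].
  exact: entry_supp.
move=> m mP; have [v kv vm] := VP m mP; have [wtm Um] := WP m mP.
have low (j : 'I_d) : (lam k0 < j)%N ->
    (\sum_(k < e.+1) (lam k == j) = \sum_(k < e.+1 | (k < k0)%N) (lam k == j))%N.
  move=> k0j; rewrite (bigID (fun k : 'I_e.+1 => k < k0)%N) /=.
  rewrite [X in (_ + X)%N]big1 ?addn0 // => k; rewrite -leqNgt => /lam_dec kk0.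
  by apply/eqP; rewrite eqb0 -val_eqE neq_ltn (leq_ltn_trans kk0).
apply: prec_low => //; apply: (@grevlex_dominance _ _ _ v).
- have sumE : (\sum_(k < e.+1) s k = \sum_(k < e.+1) k)%N.
    by rewrite [RHS](reindex_inj (@perm_inj _ s)).
  move: wtm; rewrite big_split /= -wt_m0 sumE => /eqP.
  by rewrite eqn_add2r => /eqP.
- by rewrite m0E low // (leq_trans _ (vm v)) // eqxx addn1.
- move=> j vj; rewrite m0E low ?(ltn_trans kv) // (leq_trans _ (vm j)) //.
  by rewrite leq_addr.
Qed.

(** The element is the difference of the two determinants in Cramer's rule, with [K] as the vector
    of unknowns, whose last entry is 1. The identity permutation in [\det M] gives [m0]; the other
    terms of [\det M] are smaller by [det_term], and all terms of [\det M'] are smaller because they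
    have smaller weight. *)
Lemma lead_element : exists2 p : R, p \in I &
  supported (fun m => prec pri m m0) (p - 'X_[m0]).
Proof.
have [K [h [Km h_low cong]]] := quotient_congruence.
have /andP [/monicP K1 /eqP Ks] := Km.
pose v (k : 'I_e.+1) := h`_(d + k - (lam k).+1).
pose M' : 'M[R]_e.+1 := \matrix_(k, l) if l == ord_max then v k else M k l.
exists (\det M - \det M').
  rewrite (@det_replace_col _ _ M (fun l => K`_l) v ord_max); last first.
    by rewrite -K1 /lead_coef Ks.
  apply: rpred_sum => k _; rewrite mulrC; apply: ideal_gen_mull.
  suff -> : \sum_l M k l * K`_l - v k = (g i * K - h)`_(d + k - (lam k).+1).
    exact: cong.
  rewrite coefB; congr (_ - _).
  have KE : K = \sum_(l < e.+1) K`_l *: 'X^l by rewrite -Ks -poly_def coefK.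
  rewrite [in RHS]KE mulr_sumr coef_sum; apply: eq_bigr => l _.
  by rewrite -scalerAr coefZ mxE mulrC.
have -> : \det M = 'X_[m0] + \sum_(s : {perm 'I_e.+1} | s != 1%g)
    (-1) ^+ s * \prod_k M k (s k).
  rewrite /determinant (bigD1 1%g) //= odd_perm1 expr0 mul1r; congr (_ + _).
  by rewrite /m0 -mprodXE; apply: eq_bigr => k _; rewrite perm1 entry_diag.
rewrite addrAC [_ - 'X_[_]]addrAC addrN add0r.
apply: supportedB.
  apply: supported_sum => s s1; rewrite mulr_sign.
  by case: ifP => _; [apply: supportedN|]; apply: det_term.
rewrite /determinant; apply: supported_sum => s _; rewrite mulr_sign.
suff : supported (fun m => prec pri m m0) (\prod_k M' k (s k)).
  by case: ifP => // _ ?; apply: supportedN.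
(* A coefficient of [h] has weight 0 in block [i], while the entry it replaces would have weight
   [(lam k).+1 + e - k], at least 1. The extra unit at [ord_max] records this loss. *)
have WP : supported (fun m => (wt m + \sum_(k < e.+1) (k + (s k == ord_max)) <=
    \sum_(k < e.+1) ((lam k).+1 + s k))%N /\ U m) (\prod_k M' k (s k)).
  apply: (@supported_weight_prod A N wt U leq _ _ _ _ _ _ _ wt0 wtD U0 UD)
    => [//|x y z t|k].
    exact: leq_add.
  rewrite mxE; case: eqVneq => [->|_]; last first.
    by apply: supportedW (@entry_supp k (s k)) => {}m [<- ?]; rewrite addn0.
  apply: supportedW (h_low _) => {}m mlow; split; last by move=> l /ltnW; apply: mlow.
  rewrite /wt mlow // /wdeg big1 ?add0n => [|j _]; last by rewrite muln0.
  by rewrite /= addn1 addSn ltnS (leq_trans _ (leq_addl _ _)) // -ltnS.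
move=> m mP; have [wtm Um] := WP m mP.
apply: prec_low => //; apply/grevlexP; left.
have sumE : (\sum_(k < e.+1) s k = \sum_(k < e.+1) k)%N.
  by rewrite [RHS](reindex_inj (@perm_inj _ s)).
have pos : (0 < \sum_(k < e.+1) (s k == ord_max))%N.
  by rewrite (bigD1 (s^-1%g ord_max)) //= permKV eqxx.
move: wtm; rewrite !big_split /= -wt_m0 sumE addnA addnAC leq_add2r => wtm.
by rewrite (leq_trans _ wtm) // -addn1 leq_add2l.
Qed.

End Determinant.
End Block.
End LeadingElements.

(** List every [j] exactly [a j] times, sort decreasingly and keep the first [e] entries. This
    extracts from a monomial of large degree a divisor of degree [e], in the form of a partition. *)
Lemma sorted_submultiset (d : nat) (a : 'I_d -> nat) (e : nat) :
  (e <= \sum_(j < d) a j)%N -> exists lam : 'I_e -> 'I_d,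
  (forall k k' : 'I_e, (k <= k')%N -> (lam k' <= lam k)%N) /\
  (forall j, (\sum_(k < e) (lam k == j) <= a j)%N).
Proof.
move=> ea; pose rel := fun j k : 'I_d => (k <= j)%N.
pose s := sort rel (flatten [seq nseq (a j) j | j <- enum 'I_d]).
have ss : (e <= size s)%N.
  rewrite size_sort size_flatten /shape -map_comp sumnE big_map big_enum /=.
  by under eq_bigr => j _ do rewrite size_nseq.
have st : size (take e s) == e by rewrite size_takel.
pose t : e.-tuple 'I_d := Tuple st.
exists (tnth t); split=> [k k' kk'|j].
  have rel_trans : transitive rel by move=> y x z; rewrite /rel; lia.
  have rel_refl : reflexive rel by move=> x; rewrite /rel.
  have : sorted rel t.
    by apply/take_sorted/sort_sorted => x y; rewrite /rel leq_total.
  move/(sorted_leq_nth rel_trans rel_refl (tnth_default t k)) => /(_ k k').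
  by rewrite !inE size_tuple !ltn_ord -!tnth_nth; apply.
have -> : (\sum_(k < e) (tnth t k == j) = count_mem j t)%N.
  by rewrite -sum1_count big_tuple [RHS]big_mkcond; apply: eq_bigr => k _ /=; case: eqP.
have -> : a j = count_mem j s.
  rewrite (seq.permP (permEl (perm_sort _ _))) count_flatten -map_comp sumnE big_map.
  rewrite big_enum /= (bigD1 j) //= count_nseq /= eqxx mul1n big1 ?addn0 // => k kj.
  by rewrite count_nseq /= (negbTE kj).
by rewrite -[X in (_ <= count_mem j X)%N](cat_take_drop e) count_cat leq_addr.
Qed.

Lemma block_monomial_le (r : nat) (n_ : 'I_r -> nat) (m : 'X_{1.. \sum_(i < r) n_ i})
    (i : 'I_r) (e : nat) (lam : 'I_e -> 'I_(n_ i)) :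
    (forall j, (\sum_(k < e) (lam k == j) <= @block r n_ m i j)%N) ->
  (\sum_k U_(tagnat.Rank i (lam k)) <= m)%MM.
Proof.
move=> lam_m; apply/mnm_lepP => x; rewrite -(tagnat.sig2K x).
move: (tagnat.sig1 x) (tagnat.sig2 x) => i' j; rewrite mnm_sumE.
have [ii'|ii'] := eqVneq i i'.
  rewrite -ii' in j *; apply: leq_trans (lam_m j); apply: leq_sum => k _.
  by rewrite mnm1E -val_eqE tagnat.eq_Rank eqxx.
rewrite big1 // => k _; apply/eqP.
by rewrite mnm1E -val_eqE tagnat.eq_Rank (negbTE ii').
Qed.

(** * Reduction to standard monomials *)

Section Reduction.
Variables (A : comNzRingType) (f : {poly A}) (n r : nat) (n_ : 'I_r -> nat).
Hypotheses (f_monic : f \is monic) (f_deg : size f = n.+1).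
Hypothesis n_le : (\sum_(i < r) n_ i <= n)%N.
Variable pri : 'I_r -> nat.
Hypothesis pri_inj : injective pri.

Local Notation N := (\sum_(i < r) n_ i)%N.
Local Notation R := {mpoly A[N]}.
Local Notation I := (PF_ideal f n_).

Definition standard (m : 'X_{1..N}) : Prop :=
  forall i, (bdeg m i <= n - \sum_(k < r | (pri k <= pri i)%N) n_ k)%N.

Lemma nonstandard_add m u : ~ standard m -> ~ standard (u + m)%MM.
Proof.
move=> nstd std; apply: nstd => i; apply: leq_trans (std i).
by rewrite bdegD leq_addl.
Qed.

(** Some block [i] has degree above its bound, so [m] has a divisor [m0] of degree one more than the
    bound; a monomial multiple of its [lead_element] leads with [m]. *)
Lemma nonstandard_lead m : ~ standard m -> exists2 p : R, p \in I &
  supported (fun m' => prec pri m' m) (p - 'X_[m]).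
Proof.
move=> /existsNP [i /negP]; rewrite -ltnNge => /sorted_submultiset [lam [lam_dec lam_m]].
have [p pI p_low] := lead_element f_monic f_deg n_le pri_inj lam_dec.
set m0 := (\sum_k _)%MM in p_low.
have m0m : (m0 <= m)%MM := block_monomial_le lam_m.
exists ('X_[m - m0] * p); first exact: ideal_gen_mull.
have -> : 'X_[m] = 'X_[m - m0] * 'X_[m0] :> R by rewrite -mpolyXD submK.
rewrite -mulrBr; apply: (supportedM _ (@supportedX _ _ (eq (m - m0)%MM) _ erefl) p_low).
move=> _ u <- um0; rewrite -[X in prec _ _ X](submK m0m) addmC [X in prec _ _ X]addmC.
exact: precD.
Qed.

Lemma congruent_combination (T : 'X_{1..N} -> Prop) (p : R) :
    (forall m, m \in msupp p -> exists2 q : R, supported T q & 'X_[m] - q \in I) ->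
  exists2 q : R, supported T q & p - q \in I.
Proof.
suff sums s : (forall m, m \in s -> exists2 q : R, supported T q & 'X_[m] - q \in I) ->
    exists2 q : R, supported T q & \sum_(m <- s) p@_m *: 'X_[m] - q \in I.
  by move/sums; rewrite -mpolyE.
elim: s => [_|m s IH Ts].
  by exists 0; [exact: supported0 | rewrite big_nil subr0 rpred0].
have [q1 q1s q1I] := Ts m (mem_head _ _).
have [u us|q2 q2s q2I] := IH; first by apply: Ts; rewrite inE us orbT.
exists (p@_m *: q1 + q2); first by apply: supportedD => //; apply: supportedZ.
rewrite big_cons opprD addrACA rpredD // -scalerBr -mul_mpolyC.
exact: ideal_gen_mull.
Qed.

(** Well-founded induction replaces each nonstandard monomial by smaller ones. The downward closed
    [V] keeps track of size: it is trivial when only spanning matters, and bounds the remainder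
    strictly below a lead monomial in the study of the lead ideal. *)
Lemma reduction (V : 'X_{1..N} -> Prop) p :
    (forall m m', prec pri m' m -> V m -> V m') -> supported V p ->
  exists2 q : R, supported (fun m => standard m /\ V m) q & p - q \in I.
Proof.
move=> Vdown Vp; apply: congruent_combination => m /Vp.
elim: (prec_wf pri_inj m) => {}m _ IH Vm.
have [std|/nonstandard_lead [d dI d_low]] := pselect (standard m).
  by exists 'X_[m]; [exact: supportedX | rewrite subrr rpred0].
have [u um|q qs qI] := @congruent_combination (fun m => standard m /\ V m) (d - 'X_[m]).
  by apply: IH; [apply: d_low | apply: Vdown Vm; apply: d_low].
exists (- q); first exact: supportedN.
have -> : 'X_[m] - - q = d - (d - 'X_[m] - q).
  by rewrite [in RHS]opprB addrCA subKr opprK addrC.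
exact: rpredB.
Qed.

End Reduction.

(** * Splitting rings *)

Section BasisOver.
Variables (A S : comNzRingType) (phi : {rmorphism A -> S}).

(** The module structure is expressed through [phi], so that the base ring can change along a tower
    of extensions. *)
Definition generates_over (J : finType) (b : J -> S) : Prop :=
  forall s, exists a : J -> A, s = \sum_j phi (a j) * b j.

Definition free_over (J : finType) (b : J -> S) : Prop :=
  forall a : J -> A, \sum_j phi (a j) * b j = 0 -> forall j, a j = 0.

Lemma free_over_inj (J : finType) (b : J -> S) (a a' : J -> A) : free_over b ->
  \sum_j phi (a j) * b j = \sum_j phi (a' j) * b j -> a =1 a'.
Proof.
move=> bfree eq_aa' j; apply/eqP; rewrite -subr_eq0; apply/eqP.
move: j; apply: (bfree (fun j => a j - a' j)).
under eq_bigr => j _ do rewrite rmorphB mulrBl.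
by rewrite sumrB eq_aa' subrr.
Qed.

(* A one-sided inverse of a square matrix over a commutative ring is two-sided. *)
Lemma generating_family_free (J0 J : finType) (b : J0 -> S) (w : J -> S) :
    #|J| = #|J0| -> generates_over b -> free_over b -> generates_over w ->
  free_over w.
Proof.
move=> cardJ bgen bfree wgen a aw0.
have /choice [P PE] := fun j => bgen (w j).
have /choice [Q QE] := fun j => wgen (b j).
pose t (k : 'I_#|J0|) := enum_val (cast_ord (esym cardJ) k) : J.
have t_bij : bijective t.
  apply: (bij_comp (enum_val_bij J)).
  by exists (cast_ord cardJ) => k; rewrite ?cast_ordK ?cast_ordKV.
pose u (k : 'I_#|J0|) := enum_val k : J0.
have t_on : {on [pred _ | true], bijective t} := onW_bij _ t_bij.
have u_bij : bijective u := enum_val_bij J0.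
pose PM := \matrix_(k < #|J0|, l < #|J0|) P (t k) (u l).
pose QM := \matrix_(k < #|J0|, l < #|J0|) Q (u k) (t l).
(* Expanding [b] in [w] and then [w] in [b] expresses [b] in terms of itself; freeness of [b]
   identifies the coefficients. *)
have QP1 : QM *m PM = 1%:M.
  apply/matrixP => k l; rewrite !mxE.
  pose c j := \sum_(l' < #|J0|) Q (u k) (t l') * P (t l') j.
  transitivity (c (u l)); first by apply: eq_bigr => l' _; rewrite !mxE.
  transitivity ((k == l)%:R : A); last by [].
  rewrite -(inj_eq (bij_inj u_bij)).
  apply: (@free_over_inj _ b c (fun j => (u k == j)%:R) bfree).
  transitivity (b (u k)); last first.
    rewrite (bigD1 (u k)) //= eqxx rmorph1 mul1r big1 ?addr0 // => j.
    by rewrite eq_sym => /negbTE ->; rewrite rmorph0 mul0r.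
  rewrite [RHS]QE (reindex t t_on) /=.
  under eq_bigr => j _ do rewrite /c rmorph_sum mulr_suml.
  rewrite exchange_big; apply: eq_bigr => l' _ /=.
  rewrite [X in _ = _ * X]PE mulr_sumr; apply: eq_bigr => j _.
  by rewrite rmorphM mulrA.
have PQ1 := mulmx1C QP1.
pose x := \row_(k < #|J0|) a (t k).
have xP0 : x *m PM = 0.
  apply/rowP => l; rewrite !mxE.
  pose c j := \sum_(k < #|J0|) a (t k) * P (t k) j.
  transitivity (c (u l)); first by apply: eq_bigr => l' _; rewrite !mxE.
  apply: (bfree c); rewrite -[RHS]aw0.
  rewrite [RHS](reindex t t_on) /=.
  under eq_bigr => j _ do rewrite /c rmorph_sum mulr_suml.
  rewrite exchange_big; apply: eq_bigr => k _ /=.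
  rewrite [X in _ = _ * X]PE mulr_sumr; apply: eq_bigr => j _.
  by rewrite rmorphM mulrA.
have x0 : x = 0 by rewrite -[x]mulmx1 -PQ1 mulmxA xP0 mul0mx.
move=> j; have [t' _ tK] := t_bij.
by have := congr1 (fun y : 'rV_ _ => y 0 (t' j)) x0; rewrite !mxE tK.
Qed.

End BasisOver.

Section QuotientByMonic.
Variables (A : comNzRingType) (f : {poly A}) (n : nat).
Hypothesis f_monic : monic_deg f n.+1.

Local Notation Q := {poly %/ f}.
Local Notation x := (in_qpoly f 'X).

(** The quotient ring is formed modulo [mk_monic f], which is [f] itself because [f] is monic of
    positive degree; hence the successor in [f_monic]. *)
Lemma mk_monic_id : mk_monic f = f.
Proof. by case/andP: f_monic => fm /eqP fs; rewrite /mk_monic fm fs. Qed.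

(** The projection is a ring morphism, and [p] is the value at ['X] of the same polynomial with
    constant polynomials as coefficients. *)
Lemma in_qpolyE (p : {poly A}) :
  in_qpoly f p = (map_poly (qpolyC f) p).[x].
Proof.
have mapE : map_poly (qpolyC f) p = map_poly (in_qpoly f) p^:P.
  apply/polyP => k; rewrite !coef_map /=; apply/val_inj => /=.
  rewrite Pdiv.CommonRing.rmodp_small // size_polyC.
  by rewrite (leq_ltn_trans (leq_b1 _)) // size_mk_monic_gt1.
by rewrite mapE horner_map /=; congr (in_qpoly f _); rewrite -[LHS]comp_polyXr.
Qed.

Lemma qpoly_root : root (map_poly (qpolyC f) f) x.
Proof.
apply/rootP; rewrite -in_qpolyE; apply/val_inj.
by rewrite /= mk_monic_id Pdiv.RingMonic.rmodpp; case/andP: f_monic.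
Qed.

Lemma qpoly_expansion (u : Q) : u = \sum_(k < n.+1) qpolyC f (u : {poly A})`_k * x ^+ k.
Proof.
have us : (size (u : {poly A}) <= n.+1)%N.
  rewrite -ltnS; apply: leq_trans (size_mk_monic u) _; rewrite mk_monic_id.
  by case/andP: f_monic => _ /eqP ->.
have {1}-> : u = in_qpoly f u.
  by apply/val_inj; rewrite /= Pdiv.CommonRing.rmodp_small // size_mk_monic.
rewrite in_qpolyE (@horner_coef_wide _ n.+1).
  by apply: eq_bigr => k _; rewrite coef_map.
by rewrite (leq_trans (size_poly _ _)).
Qed.

Lemma qpoly_powers_free (a : nat -> A) :
  \sum_(k < n.+1) qpolyC f (a k) * x ^+ k = 0 -> forall k, (k < n.+1)%N -> a k = 0.
Proof.
pose p := \poly_(k < n.+1) a k => a0.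
have p0 : in_qpoly f p = 0.
  rewrite in_qpolyE (@horner_coef_wide _ n.+1) -?[RHS]a0.
    by apply: eq_bigr => k _; rewrite coef_map coef_poly ltn_ord.
  by rewrite (leq_trans (size_poly _ _)) // size_poly.
have : p = 0.
  rewrite -(@in_qpoly_small _ f p) ?p0 // mk_monic_id.
  by case/andP: f_monic => _ /eqP ->; rewrite ltnS size_poly.
by move=> pE k kn; have := coef_poly n.+1 a k; rewrite -/p pE coef0 kn.
Qed.

End QuotientByMonic.

(** Pass to [A[x]/(f)], which is free on the powers of [x] below the degree, split off the root [x]
    and continue with the cofactor over this new base. Products of the bases number [n.+1 * n]! =
    n.+1[!]. The third property says that [S] is generated as a ring by the image of [A] and the
    roots. *)
Lemma splitting_ring (n : nat) (A : comNzRingType) (f : {poly A}) : monic_deg f n ->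
  exists (S : comNzRingType) (phi : {rmorphism A -> S}) (xs : seq S),
  [/\ size xs = n, map_poly phi f = \prod_(x <- xs) ('X - x%:P),
      forall B : S -> Prop, subring B -> (forall a, B (phi a)) ->
        (forall x, x \in xs -> B x) -> forall s, B s &
      exists (J : finType) (b : J -> S),
        [/\ #|J| = n`!, generates_over phi b & free_over phi b]].
Proof.
elim: n A f => [|n IH] A f f_monic.
  exists A, idfun, [::]; split=> //.
    rewrite big_nil map_poly_id //; case/andP: f_monic => fm /eqP fs.
    have /size1_polyC fE : (size f <= 1)%N by rewrite fs.
    by move: fm; rewrite fE monicE lead_coefC => /eqP ->.
  exists unit, (fun=> 1); split=> [|s|a].
  - by rewrite card_unit.
  - by exists (fun=> s); rewrite (bigD1 tt) //= big1 ?addr0 ?mulr1 // => -[].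
  - by rewrite (bigD1 tt) //= big1 => [|[]//]; rewrite addr0 mulr1 => a0 [].
have [f1 ff1] := factor_theorem _ _ (qpoly_root f_monic).
have fm : monic_deg (map_poly (qpolyC f) f) n.+1.
  case/andP: f_monic => fm /eqP fs; rewrite /monic_deg monic_map //.
  by rewrite size_map_poly_id0 ?fs ?eqxx // (monicP fm) rmorph1 oner_neq0.
have f1m : monic_deg f1 n.
  apply: (@monic_deg_quotient _ ('X - (in_qpoly f 'X)%:P) f1 0 1).
  - by rewrite /monic_deg monicXsubC size_XsubC.
  - by rewrite size_poly0 size_XsubC.
  - by rewrite addr0 mulrC -ff1.
have [S [phi [xs [xsn f1E gen [J [b [Jn bgen bfree]]]]]]] := IH _ _ f1m.
pose x := phi (in_qpoly f 'X).
pose psi : {rmorphism A -> S} := phi \o qpolyC f.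
have psiE u : phi u = \sum_(k < n.+1) psi (u : {poly A})`_k * x ^+ k.
  rewrite {1}(qpoly_expansion f_monic u) rmorph_sum; apply: eq_bigr => k _.
  by rewrite rmorphM rmorphXn.
exists S, psi, (x :: xs); split.
- by rewrite /= xsn.
- rewrite map_poly_comp /= ff1 rmorphM /= f1E big_cons mulrC; congr (_ * _).
  by rewrite rmorphB /= map_polyX map_polyC.
- move=> B BP Bpsi Bxs; apply: gen => // [u|y yxs]; last first.
    by apply: Bxs; rewrite inE yxs orbT.
  rewrite psiE; apply: subring_sum => // k _; case: (BP) => B1 _ BM; apply: (BM) => //.
  have Bx : B x by apply: Bxs; rewrite mem_head.
  by elim: (k : nat) => [|l IHl]; rewrite ?expr0 // exprS; apply: BM.
exists ('I_n.+1 * J)%type, (fun kj : 'I_n.+1 * J => x ^+ kj.1 * b kj.2); split.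
- by rewrite card_prod card_ord Jn factS.
- move=> s; have [a ->] := bgen s.
  exists (fun kj : 'I_n.+1 * J => (a kj.2 : {poly A})`_kj.1).
  rewrite -(pair_bigA _
    (fun (k : 'I_n.+1) j => psi (a j : {poly A})`_k * (x ^+ k * b j))) /=.
  rewrite exchange_big; apply: eq_bigr => j _ /=.
  by rewrite psiE mulr_suml; apply: eq_bigr => k _; rewrite mulrA.
- move=> a; have -> : \sum_kj psi (a kj) * (x ^+ kj.1 * b kj.2) =
      \sum_j \sum_(k < n.+1) psi (a (k, j)) * (x ^+ k * b j).
    by rewrite exchange_big pair_bigA; apply: eq_bigr => -[].
  move=> a0 [k j].
  have c0 := bfree (fun j => \sum_(k < n.+1) qpolyC f (a (k, j)) * in_qpoly f 'X ^+ k).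
  (* Independence of the powers is stated for coefficients indexed by natural numbers; [inord]
     extends the family indexed by ordinals. *)
  have {}c0 : \sum_(k < n.+1) qpolyC f (a (inord k, j)) * in_qpoly f 'X ^+ k = 0.
    under eq_bigr => l _ do rewrite inord_val.
    apply: c0; rewrite -[RHS]a0; apply: eq_bigr => i _.
    rewrite rmorph_sum mulr_suml; apply: eq_bigr => l _.
    by rewrite rmorphM rmorphXn mulrA.
  have := qpoly_powers_free f_monic (a := fun k => a (inord k, j)) c0 (ltn_ord k).
  by rewrite inord_val.
Qed.

(** * Linear independence of the standard monomials *)

Section AdjoiningRoots.
Variable S : comNzRingType.
Implicit Types (B : S -> Prop) (y : S) (ys : seq S).

(** Subrings are predicates on the fixed ring [S], so a tower of adjunctions never changes the
    carrier. *)
Definition spans B B' (J : finType) (w : J -> S) : Prop :=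
  forall s, B' s -> exists2 a : J -> S, forall j, B (a j) & s = \sum_j a j * w j.

Lemma spans_trans B B1 B2 (J1 J2 : finType) (w1 : J1 -> S) (w2 : J2 -> S) :
  spans B B1 w1 -> spans B1 B2 w2 ->
  spans B B2 (fun j : J2 * J1 => w2 j.1 * w1 j.2).
Proof.
move=> sp1 sp2 s /sp2 [a Ba ->].
have /choice [c cP] : forall j, exists c : J1 -> S,
    (forall k, B (c k)) /\ a j = \sum_k c k * w1 k.
  by move=> j; have [c Bc aE] := sp1 _ (Ba j); exists c.
exists (fun j => c j.1 j.2) => [j|]; first by case: (cP j.1).
rewrite -(pair_bigA _ (fun j k => c j k * (w2 j * w1 k))) /=; apply: eq_bigr => j _.
by case: (cP j) => _ ->; rewrite mulr_suml; apply: eq_bigr => k _; rewrite mulrAC mulrA.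
Qed.

(** Take for [B'] the values at [y] of polynomials over [B]; replacing such a polynomial by its
    remainder modulo [p] leaves the value unchanged and lowers the degree below [d]. *)
Lemma adjoin_root B y (p : {poly S}) d :
    subring B -> monic_deg p d -> coefs_in B p -> root p y ->
  exists B', [/\ subring B', forall s, B s -> B' s, B' y &
                 spans B B' (fun k : 'I_d => y ^+ k)].
Proof.
move=> BP /andP [pm /eqP ps] Bp /rootP py0.
have BP' := subring_additive BP; case: (BP) => B1 _ _; case: (BP') => B0 _.
exists (fun s => exists2 q, coefs_in B q & s = q.[y]); split.
- split=> [|_ _ [q Bq ->] [q' Bq' ->]|_ _ [q Bq ->] [q' Bq' ->]].
  + by exists 1; rewrite ?hornerC // => k; rewrite coef1; case: eqP.
  + by exists (q - q'); rewrite ?hornerD ?hornerN //; apply: coefs_in_sub.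
  + by exists (q * q'); rewrite ?hornerM //; apply: coefs_in_mul.
- by move=> s Bs; exists s%:P; rewrite ?hornerC // => k; rewrite coefC; case: eqP.
- by exists 'X; rewrite ?hornerX // => k; rewrite coefX; case: eqP.
- move=> _ [q Bq ->].
  pose u := Pdiv.CommonRing.rdivp q p; pose v := Pdiv.CommonRing.rmodp q p.
  have qE : q = p * u + v by rewrite [LHS](Pdiv.RingMonic.rdivp_eq pm q) mulrC.
  have vp : (size v < size p)%N by rewrite Pdiv.CommonRing.ltn_rmodp (monic_neq0 pm).
  have Bu : coefs_in B u by apply: (monic_dvd_coefs BP pm Bp vp); rewrite -qE.
  have Bv : coefs_in B v.
    have -> : v = q - p * u by rewrite qE addrC addKr.
    by apply: coefs_in_sub => //; apply: coefs_in_mul.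
  exists (fun k : 'I_d => v`_k) => //.
  rewrite qE hornerD hornerM py0 mul0r add0r (@horner_coef_wide _ d) //.
  by rewrite -ltnS -ps.
Qed.

Lemma prod_XsubC_monic_deg ys : monic_deg (\prod_(y <- ys) ('X - y%:P)) (size ys).
Proof. by rewrite /monic_deg monic_prod_XsubC size_prod_XsubC eqxx. Qed.

(** Once [y] is adjoined, the factor ['X - y%:P] can be divided out over the larger ring, so the
    degree drops by one at each step and the numbers of generators multiply to a factorial. *)
Lemma adjoin_roots ys B : subring B -> coefs_in B (\prod_(y <- ys) ('X - y%:P)) ->
  exists B' (J : finType) (w : J -> S),
  [/\ subring B', forall s, B s -> B' s, forall y, y \in ys -> B' y,
      #|J| = (size ys)`! & spans B B' w].
Proof.
elim: ys B => [|y ys IH] B BP Bys.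
  exists B, unit, (fun=> 1); split=> // [|s Bs]; first by rewrite card_unit.
  by exists (fun=> s) => //; rewrite (bigD1 tt) //= big1 ?addr0 ?mulr1 // => -[].
have [|B1 [B1P BB1 B1y sp1]] :=
    adjoin_root BP (prod_XsubC_monic_deg (y :: ys)) Bys (y := y).
  by apply/rootP; rewrite big_cons hornerM hornerXsubC subrr mul0r.
have B1ys : coefs_in B1 (\prod_(z <- ys) ('X - z%:P)).
  apply: (@monic_dvd_coefs _ _ ('X - y%:P) _ 0) => //.
  - by rewrite monicXsubC.
  - move=> k; rewrite coefB coefX coefC; case: (B1P) => B11 B1B _.
    have [B10 _] := subring_additive B1P.
    by apply: B1B; case: eqP.
  - by rewrite size_poly0 size_XsubC.
  - by move=> k; rewrite addr0; have := BB1 _ (Bys k); rewrite big_cons.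
have [B2 [J [w [B2P B12 B2ys cardJ sp2]]]] := IH _ B1P B1ys.
exists B2, (J * 'I_(size (y :: ys)))%type,
  (fun j : J * 'I_(size (y :: ys)) => w j.1 * y ^+ j.2); split=> //.
- by move=> s /BB1 /B12.
- by move=> z; rewrite inE => /predU1P [->|/B2ys //]; apply: B12.
- by rewrite card_prod cardJ card_ord factS mulnC.
- exact: spans_trans sp1 sp2.
Qed.

Lemma adjoin_root_blocks (yss : seq (seq S)) B :
    subring B -> (forall ys, ys \in yss -> coefs_in B (\prod_(y <- ys) ('X - y%:P))) ->
  exists B' (J : finType) (w : J -> S),
  [/\ subring B', forall s, B s -> B' s,
      forall ys y, ys \in yss -> y \in ys -> B' y,
      #|J| = (\prod_(ys <- yss) (size ys)`!)%N & spans B B' w].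
Proof.
elim: yss B => [|ys yss IH] B BP Bys.
  exists B, unit, (fun=> 1); split=> // [|s Bs]; first by rewrite card_unit big_nil.
  by exists (fun=> s) => //; rewrite (bigD1 tt) //= big1 ?addr0 ?mulr1 // => -[].
have [B1 [J1 [w1 [B1P BB1 B1ys card1 sp1]]]] := adjoin_roots BP (Bys _ (mem_head _ _)).
have [|B2 [J2 [w2 [B2P B12 B2ys card2 sp2]]]] := IH _ B1P.
  by move=> zs zss k; apply/BB1/Bys; rewrite inE zss orbT.
exists B2, (J2 * J1)%type, (fun j => w2 j.1 * w1 j.2); split=> //.
- by move=> s /BB1 /B12.
- by move=> zs z; rewrite inE => /predU1P [->|/B2ys //] => [/B1ys /B12|h /h].
- by rewrite card_prod card1 card2 big_cons mulnC.
- exact: spans_trans sp1 sp2.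
Qed.

End AdjoiningRoots.

Section Independence.
Variables (A : comNzRingType) (f : {poly A}) (n r : nat) (n_ : 'I_r -> nat).
Hypotheses (f_monic : f \is monic) (f_deg : size f = n.+1).
Hypothesis n_le : (\sum_(i < r) n_ i <= n)%N.

Local Notation N := (\sum_(i < r) n_ i)%N.
Local Notation R := {mpoly A[N]}.
Local Notation g := (@generic_factor A r n_).
Local Notation I := (PF_ideal f n_).
Local Notation fR := (map_poly (@mpolyC N A) f).

Section Specialization.
Variables (S : comNzRingType) (phi : {rmorphism A -> S}) (xs : seq S).
Hypothesis size_xs : size xs = n.
Hypothesis f_split : map_poly phi f = \prod_(x <- xs) ('X - x%:P).

(** The numbering of the variables also distributes the first [N] roots among the blocks; the
    remaining ones are [drop N xs]. *)
Definition block_roots i := [seq xs`_(tagnat.Rank i j) | j <- enum 'I_(n_ i)].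

Definition block_poly i : {poly S} := \prod_(x <- block_roots i) ('X - x%:P).

Definition specialization : {rmorphism R -> S} :=
  mmap phi (fun x : 'I_N => let p := tagnat.sig x in
    (block_poly (tag p))`_(n_ (tag p) - (tagged p).+1)).

Lemma specialization_const a : specialization a%:MP = phi a.
Proof. exact: mmapC. Qed.

Lemma size_block_roots i : size (block_roots i) = n_ i.
Proof. by rewrite size_map size_enum_ord. Qed.

Lemma block_poly_monic i : monic_deg (block_poly i) (n_ i).
Proof. by rewrite -[X in monic_deg _ X]size_block_roots prod_XsubC_monic_deg. Qed.

Lemma map_generic_factor i : map_poly specialization (g i) = block_poly i.
Proof.
have /andP [/monicP bm /eqP bs] := block_poly_monic i.
apply/polyP => u; rewrite coef_map; case: generic_coefP => [ud|->|j uj].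
- by rewrite raddf0 nth_default ?bs.
- have -> : (block_poly i)`_(n_ i) = 1 by rewrite -bm /lead_coef bs.
  exact: rmorph1.
- have -> : u = (n_ i - j.+1)%N by lia.
  by rewrite /= mmapX mmap1U tagnat.rankK.
Qed.

Lemma map_const_poly : map_poly specialization fR = map_poly phi f.
Proof. by apply/polyP => k; rewrite !coef_map; apply: specialization_const. Qed.

Lemma prod_roots_split : \prod_(x <- xs) ('X - x%:P) =
  (\prod_(i < r) block_poly i) * \prod_(x <- drop N xs) ('X - x%:P).
Proof.
rewrite -[in LHS](cat_take_drop N xs) big_cat /=; congr (_ * _).
have sN : size (take N xs) = N by rewrite size_takel // size_xs.
rewrite (big_nth 0) sN big_mkord.
rewrite (reindex _ tagnat.rank_bij_on) /=.
under [RHS]eq_bigr => i _ do rewrite /block_poly /block_roots big_map big_enum.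
rewrite sig_big_dep /=; apply: eq_bigr => p _.
by rewrite nth_take ?(ltn_ord (tagnat.rank p)) //; case: p.
Qed.

(** The division of [fR] by [G] maps to a division of the image of [f] by [G'], which divides it
    exactly with quotient [L]. Uniqueness of division by a monic polynomial makes the image of the
    remainder zero. *)
Lemma specialization_ideal p : p \in I -> specialization p = 0.
Proof.
pose G := \prod_(i < r) g i.
have [Gm Gs] : G \is monic /\ size G = N.+1.
  suff /andP [? /eqP ?] : monic_deg G N by [].
  by apply: monic_deg_prod => i _; apply: generic_factor_monic.
pose G' := \prod_(i < r) block_poly i.
have [G'm G's] : G' \is monic /\ size G' = N.+1.
  suff /andP [? /eqP ?] : monic_deg G' N by [].
  by apply: monic_deg_prod => i _; apply: block_poly_monic.
have GG' : map_poly specialization G = G'.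
  by rewrite rmorph_prod; apply: eq_bigr => i _; apply: map_generic_factor.
pose L := \prod_(x <- drop N xs) ('X - x%:P).
pose Q := Pdiv.CommonRing.rdivp fR G; pose rem := Pdiv.CommonRing.rmodp fR G.
have fQ : fR = G * Q + rem by rewrite [in LHS](Pdiv.RingMonic.rdivp_eq Gm fR) mulrC.
have rem_lt : (size rem < size G)%N by rewrite Pdiv.CommonRing.ltn_rmodp (monic_neq0 Gm).
pose Q' := map_poly specialization Q; pose rem' := map_poly specialization rem.
have fE : G' * L = G' * Q' + rem'.
  have mapE :
      map_poly specialization (G * Q + rem) = map_poly specialization G * Q' + rem'.
    by rewrite rmorphD rmorphM.
  by rewrite -prod_roots_split -f_split -map_const_poly fQ mapE GG'.
have rem'_lt : (size rem' < size G')%N.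
  by rewrite G's -Gs (leq_ltn_trans _ rem_lt) // size_poly.
have LQ : L - Q' = 0.
  apply/polyP => k; rewrite coef0; move: k.
  (* Uniqueness is the case of the zero ideal: [G' * (L - Q') - rem'] vanishes, hence so does
     [L - Q']. *)
  apply: (@monic_quotient_coefs _ (fun x : S => x = 0) G' _ (- rem')) => //.
  - by split=> // _ _ -> ->; rewrite subr0.
  - by move=> _ k ->; rewrite mul0r.
  - by rewrite size_polyN.
  - by move=> k; rewrite mulrBr fE [_ + rem']addrC addrK subrr coef0.
have rem0 : rem' = 0.
  by apply: (addrI (G' * Q')); rewrite -fE addr0 (subr0_eq LQ).
case/asboolP=> k [a [s [sI ->]]]; rewrite rmorph_sum big1 // => l _.
have [t ->] := sI l; rewrite rmorphM.
have -> : specialization rem`_t = 0.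
  by rewrite -(coef_map specialization) -/rem' rem0 coef0.
by rewrite mulr0.
Qed.

Lemma specialization_scale a p : specialization (a *: p) = phi a * specialization p.
Proof. exact: mmapZ. Qed.

Definition image_ring (s : S) : Prop := exists p : R, s = specialization p.

Lemma image_subring : subring image_ring.
Proof.
split=> [|_ _ [p ->] [q ->]|_ _ [p ->] [q ->]].
- by exists 1; rewrite rmorph1.
- by exists (p - q); rewrite rmorphB.
- by exists (p * q); rewrite rmorphM.
Qed.

Lemma block_poly_image i : coefs_in image_ring (block_poly i).
Proof. by move=> k; rewrite -map_generic_factor coef_map; exists (g i)`_k. Qed.

(** The image of [f] and the monic product of the block polynomials have coefficients in the image
    ring, hence so does their quotient. *)
Lemma last_factor_image : coefs_in image_ring (\prod_(x <- drop N xs) ('X - x%:P)).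
Proof.
have /andP [G'm /eqP G's] : monic_deg (\prod_(i < r) block_poly i) N.
  by apply: monic_deg_prod => i _; apply: block_poly_monic.
apply: (@monic_dvd_coefs _ _ _ _ 0 image_subring G'm).
- by apply: coefs_in_prod => [|i _]; [apply: image_subring|apply: block_poly_image].
- by rewrite size_poly0 G's.
- rewrite addr0 -prod_roots_split -f_split => k; rewrite coef_map.
  by exists (f`_k)%:MP; rewrite specialization_const.
Qed.

(** Starting from the image of [R], adjoin the roots of each block and those of the last factor. The
    resulting ring contains the constants and all the roots, so it is all of [S]. *)
Lemma splitting_spanned : (forall B : S -> Prop, subring B -> (forall a, B (phi a)) ->
    (forall x, x \in xs -> B x) -> forall s, B s) ->
  exists (J : finType) (w : J -> S),
    #|J| = ((n - N)`! * \prod_i (n_ i)`!)%N /\ spans image_ring (fun=> True) w.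
Proof.
move=> gen; pose yss := drop N xs :: [seq block_roots i | i <- enum 'I_r].
have [|B [J [w [BP imB rootsB cardJ sp]]]] :=
    adjoin_root_blocks (yss := yss) image_subring.
  move=> ys; rewrite inE => /predU1P [->|/mapP [i _ ->]]; first exact: last_factor_image.
  exact: block_poly_image.
exists J, w; split.
  rewrite cardJ big_cons size_drop size_xs big_map big_enum /=.
  by congr (_ * _)%N; apply: eq_bigr => i _; congr factorial; apply: size_block_roots.
move=> s _; apply: sp; apply: gen => // [a|x xxs].
  by apply: imB; exists a%:MP; rewrite specialization_const.
have := xxs; rewrite -{1}[xs](cat_take_drop N) mem_cat => /orP [|xd]; last first.
  by apply: (rootsB _ _ (mem_head _ _) xd).
case/(nthP 0) => k; rewrite size_takel ?size_xs // => kN <-.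
pose o := Ordinal kN; pose i := tagnat.sig1 o.
apply: (rootsB (block_roots i)); first by rewrite inE map_f ?orbT ?mem_enum.
apply/mapP; exists (tagnat.sig2 o); first by rewrite mem_enum.
by rewrite tagnat.sig2K nth_take.
Qed.

End Specialization.

(** By [reduction], the images of the monomials [v j] span the image of [R] over [A], and the family
    [w] spans [S] over that image. The products span [S] and number [n!], the size of a basis, so
    they are free. *)
Lemma standard_independent (pri : 'I_r -> nat) (J : finType) (v : J -> 'X_{1..N}) q :
    injective pri -> injective v ->
    (forall m, standard n pri m -> exists j, m = v j) ->
    (#|J| * ((n - N)`! * \prod_i (n_ i)`!) = n`!)%N ->
    q \in I -> supported (fun m => exists j, m = v j) q ->
  q = 0.
Proof.
move=> pri_inj v_inj v_std cardJ qI qv.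
have fm : monic_deg f n by rewrite /monic_deg f_monic f_deg eqxx.
have [S [phi [xs [xsn f_split gen [J0 [b [cardJ0 bgen bfree]]]]]]] := splitting_ring fm.
have [K [w [cardK sp]]] := splitting_spanned xsn f_split gen.
pose psi := specialization phi xs.
have sumE (p : R) : supported (fun m => exists j, m = v j) p ->
    psi p = \sum_j phi p@_(v j) * psi 'X_[v j].
  move=> pv; have {1}-> : p = \sum_j p@_(v j) *: 'X_[v j].
    apply/mpolyP => m; rewrite raddf_sum /=.
    have [/pv [j ->]|mp] := boolP (m \in msupp p).
      rewrite (bigD1 j) //= mcoeffZ mcoeffX eqxx mulr1 [X in _ + X]big1 => [|k kj].
        by rewrite addr0.
      by rewrite mcoeffZ mcoeffX (inj_eq v_inj) (negbTE kj) mulr0.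
    rewrite memN_msupp_eq0 // [RHS]big1 // => j _; rewrite mcoeffZ mcoeffX.
    by case: eqP => [vm|_]; rewrite ?mulr0 // mulr1 vm memN_msupp_eq0.
  by rewrite rmorph_sum; apply: eq_bigr => j _; rewrite specialization_scale.
have wfree : free_over phi (fun jk : J * K => psi 'X_[v jk.1] * w jk.2).
  apply: (generating_family_free _ bgen bfree) => [|s].
    by rewrite card_prod cardK cardJ.
  have [a aim ->] := sp s Logic.I.
  have /choice [c cE] : forall k, exists c : J -> A, a k = \sum_j phi (c j) * psi 'X_[v j].
    move=> k; have [p ->] := aim k.
    have [//|//|p' p's pp'] :=
      @reduction _ _ _ _ _ f_monic f_deg n_le _ pri_inj (fun=> True) p.
    exists (fun j => p'@_(v j)); rewrite -sumE; last first.
      by apply: supportedW p's => m [/v_std].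
    apply/eqP; rewrite -subr_eq0 -rmorphB; apply/eqP.
    exact: (specialization_ideal xsn f_split pp').
  exists (fun jk => c jk.2 jk.1).
  rewrite -(pair_bigA _ (fun j k => phi (c k j) * (psi 'X_[v j] * w k))) /=.
  rewrite exchange_big; apply: eq_bigr => k _ /=.
  by rewrite cE mulr_suml; apply: eq_bigr => j _; rewrite mulrA.
have /card_gt0P [k0 _] : (0 < #|K|)%N.
  by rewrite cardK muln_gt0 fact_gt0 prodn_gt0 // => i; apply: fact_gt0.
apply/mpolyP => m; rewrite mcoeff0.
have [/qv [j ->]|] := boolP (m \in msupp q); last exact: memN_msupp_eq0.
(* Multiplying the relation [psi q = 0] by the single element [w k0] gives a relation among the
   products. *)
have := wfree (fun jk => if jk.2 == k0 then q@_(v jk.1) else 0) _ (j, k0).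
rewrite eqxx; apply.
rewrite -(pair_bigA _
  (fun j k => phi (if k == k0 then q@_(v j) else 0) * (psi 'X_[v j] * w k))) /=.
rewrite exchange_big (bigD1 k0) //= [X in _ + X]big1 ?addr0 => [|k kk0]; last first.
  by rewrite big1 // => l _; rewrite (negbTE kk0) rmorph0 mul0r.
under eq_bigr => l _ do rewrite eqxx mulrA.
by rewrite -mulr_suml -sumE // (specialization_ideal xsn f_split qI) mul0r.
Qed.

End Independence.

(** * Counting standard monomials *)

Section Counting.
Variables (n r : nat) (n_ : 'I_r -> nat).
Hypothesis n_le : (\sum_(i < r) n_ i <= n)%N.
Variable pri : 'I_r -> nat.
Hypothesis pri_inj : injective pri.

Local Notation N := (\sum_(i < r) n_ i)%N.

Lemma multinomial_telescope :
  (\prod_(i < r) 'C(n - \sum_(k < r | pri k < pri i) n_ k, n_ i) *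
     ((n - N)`! * \prod_(i < r) (n_ i)`!) = n`!)%N.
Proof.
suff telescope t :
    (\prod_(i < r | pri i < t)
       ('C(n - \sum_(k < r | pri k < pri i) n_ k, n_ i) * (n_ i)`!) *
    (n - \sum_(k < r | pri k < t) n_ k)`! = n`!)%N.
  have lt_max i : (pri i < (\max_k pri k).+1)%N by rewrite ltnS leq_bigmax.
  rewrite mulnCA mulnC -big_split /= -[RHS](telescope (\max_k pri k).+1).
  congr (_ * (n - _)`!)%N; first by apply: eq_bigl => i; rewrite lt_max.
  by apply: eq_bigl => i; rewrite lt_max.
elim: t => [|t IHt]; first by rewrite !big_pred0 // mul1n subn0.
have [/existsP [i /eqP it]|/existsPn nt] := boolP [exists i, pri i == t]; last first.
  have ltE k : (pri k < t.+1)%N = (pri k < t)%N.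
    by rewrite ltnS leq_eqVlt (negbTE (nt k)).
  by rewrite -[RHS]IHt; congr (_ * (n - _)`!)%N; apply: eq_bigl.
have ltE k : (pri k < t.+1)%N && (k != i) = (pri k < t)%N.
  rewrite ltnS leq_eqVlt -it (inj_eq pri_inj).
  by case: eqVneq => [->|_] /=; rewrite ?ltnn ?andbT.
have sumE : (\sum_(k < r | pri k < t.+1) n_ k =
    n_ i + \sum_(k < r | pri k < t) n_ k)%N.
  by rewrite (bigD1 i) /= ?it //; congr (_ + _)%N; apply: eq_bigl.
have sum_le : (\sum_(k < r | pri k < t.+1) n_ k <= n)%N.
  by rewrite (leq_trans _ n_le) // [leqRHS](bigID (fun k => pri k < t.+1)%N) leq_addr.
rewrite (bigD1 i) /= ?it // (eq_bigl _ _ ltE) -[RHS]IHt sumE.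
set s := (\sum_(k < r | pri k < t) n_ k)%N in sumE *.
rewrite -(@bin_fact (n - s) (n_ i)); last by rewrite leq_subRL; lia.
by rewrite addnC subnDA mulnAC [RHS]mulnC !mulnA.
Qed.

(** The bounds concern the blocks separately, so the count is a product. In block [i] the exponents
    form a tuple of [n_ i] naturals of sum at most [D i], and there are ['C(n_ i + D i, n_ i)] of
    these. *)
Lemma standard_enumeration : exists (J : finType) (v : J -> 'X_{1..N}),
  [/\ injective v, forall m, standard n pri m <-> exists j, m = v j &
      #|J| = (\prod_(i < r) 'C(n - \sum_(k < r | pri k < pri i) n_ k, n_ i))%N].
Proof.
pose D i := (n - \sum_(k < r | (pri k <= pri i)%N) n_ k)%N.
pose T i := {t : (n_ i).-tuple 'I_(D i).+1 | (\sum_(j <- t) j <= D i)%N}.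
pose v (F : {dffun forall i, T i}) : 'X_{1..N} :=
  [multinom tnth (val (F (tagnat.sig1 x))) (tagnat.sig2 x) : nat | x < N].
have vE F i j : v F (tagnat.Rank i j) = tnth (val (F i)) j.
  rewrite mnmE /tagnat.sig2 /tagnat.sig1.
  by rewrite /tagnat.Rank tagnat.rankK.
exists {dffun forall i, T i}, v; split.
- move=> F G FG; apply/ffunP => i; apply/val_inj/eq_from_tnth => j.
  by apply/val_inj; rewrite /= -!vE FG.
- move=> m; split=> [m_std|[F ->] i].
    have bound i j : (m (tagnat.Rank i j) <= D i)%N.
      by apply: leq_trans (m_std i); rewrite /bdeg (bigD1 j) //= leq_addr.
    pose t i : (n_ i).-tuple 'I_(D i).+1 :=
      [tuple inord (m (tagnat.Rank i j)) | j < n_ i].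
    have tP i : (\sum_(x <- t i) x <= D i)%N.
      rewrite big_tuple.
      under eq_bigr => j _ do rewrite tnth_mktuple inordK ?ltnS ?bound //.
      exact: m_std.
    exists (finfun (fun i => Sub (t i) (tP i) : T i)); apply/mnmP => x.
    rewrite -[x]tagnat.sig2K vE ffunE /= tnth_mktuple inordK // ltnS.
    exact: bound.
  apply: leq_trans (valP (F i)); rewrite big_tuple /bdeg.
  by apply: leq_sum => j _; rewrite /block vE.
- rewrite card_dep_ffun foldrE big_map big_enum; apply: eq_bigr => i _ /=.
  rewrite card_sig; have := card_partial_ord_partitions (n_ i) (D i).
  rewrite cardsE => ->; congr 'C(_, _).
  (* Adding [n_ i] to [D i] undoes the subtraction of block [i]; this is exact since the partial
     sums do not exceed [n]. *)
  have := sum_pri_le n_le (fun k => pri k <= pri i)%N.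
  rewrite /D (sum_pri_split n_ pri_inj i); set s := (\sum_(k < r | _) _)%N.
  by move=> ?; lia.
Qed.

End Counting.

(** * The lead ideal and the quotient *)

Section LeadIdeal.
Variables (A : comNzRingType) (f : {poly A}) (n r : nat) (n_ : 'I_r -> nat).
Hypotheses (f_monic : f \is monic) (f_deg : size f = n.+1).
Hypothesis n_le : (\sum_(i < r) n_ i <= n)%N.

Local Notation N := (\sum_(i < r) n_ i)%N.
Local Notation R := {mpoly A[N]}.
Local Notation I := (PF_ideal f n_).

Lemma supported_standard_ideal (pri : 'I_r -> nat) (q : R) : injective pri ->
  q \in I -> supported (standard n pri) q -> q = 0.
Proof.
move=> pri_inj qI q_std.
have [J [v [v_inj vP cardJ]]] := standard_enumeration n_le pri_inj.
apply: (standard_independent f_monic f_deg n_le pri_inj v_inj _ _ qI).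
- by move=> m /vP.
- by rewrite cardJ multinomial_telescope.
- by apply: supportedW q_std => m /vP.
Qed.

(** If [m] were standard, reducing the lower terms of [p] to standard monomials below [m] would give
    a standard element of the ideal with the nonzero coefficient [p@_m], against independence. *)
Lemma lead_monomial_nonstandard (p : R) m : p \in I ->
  is_lead_monomial block_lt p m -> ~ standard n (@nat_of_ord r) m.
Proof.
move=> pI [mp lead_m] m_std.
have low : supported (fun m' => prec (@nat_of_ord r) m' m) (p - p@_m *: 'X_[m]).
  move=> m'; rewrite mcoeff_msupp mcoeffB mcoeffZ mcoeffX.
  have [<-|mm'] := eqVneq m m'; first by rewrite mulr1 subrr eqxx.
  rewrite mulr0 subr0 -mcoeff_msupp => m'p; apply/block_ltP/lead_m => //.
  by rewrite eq_sym.
have [m1 m2|q qs pq] := reduction f_monic f_deg n_le val_inj _ low.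
  by apply: prec_trans; apply: val_inj.
have q0 : p@_m *: 'X_[m] + q = 0.
  apply: (supported_standard_ideal val_inj).
    have -> : p@_m *: 'X_[m] + q = p - (p - p@_m *: 'X_[m] - q).
      by rewrite [in RHS]opprB [RHS]addrCA subKr addrC.
    exact: rpredB.
  apply: supportedD; first by apply: supportedZ; apply: supportedX.
  by apply: supportedW qs => ? [].
have := congr1 (mcoeff m) q0; rewrite mcoeffD mcoeffZ mcoeffX eqxx mulr1 mcoeff0.
rewrite [q@__]memN_msupp_eq0 ?addr0 => [pm0|].
  by move: mp; rewrite mcoeff_msupp pm0 eqxx.
by apply/negP => /qs [_ /prec_irr].
Qed.

(** Lead monomials are nonstandard; conversely each nonstandard monomial is itself the lead term,
    with coefficient 1, of an element of the ideal. This coefficient is what makes the ideal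
    monic. *)
Lemma lead_idealP (p : R) : p \in lead_ideal block_lt I <->
  supported (fun m => ~ standard n (@nat_of_ord r) m) p.
Proof.
have up (m u : 'X_{1..N}) : ~ standard n (@nat_of_ord r) m ->
  ~ standard n (@nat_of_ord r) (u + m)%MM by apply: nonstandard_add.
split=> [/asboolP [k [a [s [sP ->]]]]|p_std].
  apply: supported_sum => i _; have [q [m [qI qm ->]]] := sP i.
  apply: (@supportedM _ _ (fun=> True) (fun m => ~ standard n (@nat_of_ord r) m)) => //.
    by move=> u v _; apply: up.
  by apply: supportedZ; apply: supportedX; apply: lead_monomial_nonstandard qm.
rewrite [p]mpolyE [X in X \in _]big_seq; apply: rpred_sum => m /p_std nstd.
rewrite -mul_mpolyC; apply: ideal_gen_mull; apply: ideal_gen_mem.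
have [q qI q_low] := nonstandard_lead f_monic f_deg n_le val_inj nstd.
have qm : q@_m = 1.
  have : (q - 'X_[m])@_m = 0.
    by apply: memN_msupp_eq0; apply/negP => /q_low /prec_irr.
  by rewrite mcoeffB mcoeffX eqxx => /subr0_eq.
exists q, m; split=> //; last by rewrite qm scale1r.
split; first by rewrite mcoeff_msupp qm oner_neq0.
move=> m' m'q m'm; apply/block_ltP/q_low; rewrite mcoeff_msupp mcoeffB mcoeffX.
by rewrite [m == _]eq_sym (negbTE m'm) subr0 -mcoeff_msupp.
Qed.

Lemma block_ideal_exp_supported i e (p : R) : p \in ideal_exp (block_ideal A i) e ->
  supported (fun m => (e <= bdeg m i)%N) p.
Proof.
have gen (q : R) : q \in block_ideal A i -> supported (fun m => (1 <= bdeg m i)%N) q.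
  case/asboolP=> k [a [s [sP ->]]]; apply: supported_sum => l _; have [j ->] := sP l.
  apply: (@supportedM _ _ (fun=> True) (fun m => (1 <= bdeg m i)%N)) => //.
    by move=> m u _ mu; rewrite bdegD (leq_trans mu) ?leq_addl.
  by apply: supportedX; rewrite /bdeg (bigD1 j) //= block_var !eqxx.
case/asboolP=> k [a [s [sP ->]]]; apply: supported_sum => l _; have [t tI ->] := sP l.
apply: (@supportedM _ _ (fun=> True) (fun m => (e <= bdeg m i)%N)) => //.
  by move=> m u _ mu; rewrite bdegD (leq_trans mu) ?leq_addl.
have := @supported_weight_prod A N (fun m => bdeg m i) (fun=> True)
  (fun x y => (y <= x)%N) _ (index_enum 'I_e) t (fun=> 0%N) (fun=> 1%N).
rewrite big1_eq sum1_card card_ord => H.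
apply: supportedW (H _ _ _ _ _ _ _) => // [m [] | x y z w | | m u | k'].
- by rewrite addn0.
- exact: leq_add.
- by rewrite /bdeg big1 // => j _; rewrite block0.
- exact: bdegD.
- by apply: supportedW (gen _ (tI k')) => m; rewrite addn0.
Qed.

Lemma monomial_block_ideal_exp i e m : (e <= bdeg m i)%N ->
  'X_[m] \in ideal_exp (@block_ideal A r n_ i) e.
Proof.
case/sorted_submultiset=> lam [_ lam_m].
pose m0 : 'X_{1..N} := (\sum_k U_(tagnat.Rank i (lam k)))%MM.
have m0m : (m0 <= m)%MM := block_monomial_le lam_m.
rewrite -(submK m0m) mpolyXD; apply: ideal_gen_mull; apply: ideal_gen_mem.
exists (fun k => 'X_(tagnat.Rank i (lam k))); last by rewrite /m0 mprodXE.
by move=> k; apply: ideal_gen_mem; exists (lam k).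
Qed.

(** Both sides are monomial conditions: a monomial violating the bound in block [i] is put entirely
    into the summand of that block. *)
Lemma block_ideal_sumP (e : 'I_r -> nat) (p : R) :
  p \in ideal_sum (fun i => ideal_exp (block_ideal A i) (e i + 1)) <->
  supported (fun m => ~ forall i, (bdeg m i <= e i)%N) p.
Proof.
split=> [/asboolP [q qI ->]|p_supp].
  apply: supported_sum => i _; apply: supportedW (block_ideal_exp_supported (qI i)).
  by move=> m; rewrite addn1 => lt_m /(_ i); rewrite leqNgt lt_m.
apply/asboolP.
have addS (q q' : 'I_r -> R) : (forall i, q i \in ideal_exp (block_ideal A i) (e i + 1)) ->
    (forall i, q' i \in ideal_exp (block_ideal A i) (e i + 1)) ->
    forall i, q i + q' i \in ideal_exp (block_ideal A i) (e i + 1).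
  by move=> qI q'I i; apply: rpredD.
have -> : p = \sum_(m <- msupp p | m \in msupp p) p@_m *: 'X_[m].
  by rewrite -big_seq -mpolyE.
apply: (big_ind (fun p => exists2 q : 'I_r -> R,
  forall i, q i \in ideal_exp (block_ideal A i) (e i + 1) & p = \sum_i q i)).
- by exists (fun=> 0) => [i|]; [apply: rpred0 | apply/esym/big1].

- move=> _ _ [q qI ->] [q' q'I ->]; exists (fun i => q i + q' i); last by rewrite big_split.
  exact: addS.
- move=> m /p_supp /existsNP [i /negP].
  rewrite -ltnNge -addn1 => /monomial_block_ideal_exp mI.
  exists (fun k => if (k == i) as _ return R then p@_m *: 'X_[m] else 0) => [k|].
    case: eqVneq => [->|_]; last exact: rpred0.
    by rewrite -mul_mpolyC; apply: ideal_gen_mull.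
  by rewrite -big_mkcond big_pred1_eq.
Qed.

End LeadIdeal.

(** * Bases of the quotient module *)

Section ResidueBasis.
Variables (A : comNzRingType) (R : comAlgType A) (S : R -> Prop).

Lemma residue0 : residue S 0 = 0.
Proof. by apply: (addrI (residue S 0)); rewrite -residueD !addr0. Qed.

Lemma residue_combination (J : Type) (s : seq J) (a : J -> A) (v : J -> R) :
  \sum_(j <- s) a j *: residue S (v j) = residue S (\sum_(j <- s) a j *: v j).
Proof.
elim: s => [|j s IH]; first by rewrite !big_nil residue0.
by rewrite !big_cons residueD residueZ IH.
Qed.

End ResidueBasis.

Lemma sum_pmap_insub (V : nmodType) (T : eqType) (P : pred T) (sT : subType P)
    (s : seq T) (F : T -> V) : (forall x, x \in s -> P x) ->
  \sum_(y <- pmap (insub : T -> option sT) s) F (val y) = \sum_(x <- s) F x.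
Proof.
elim: s => [|x s IH] sP; first by rewrite !big_nil.
rewrite /= insubT ?sP ?mem_head // => Px; rewrite /= !big_cons SubK IH //.
by move=> y ys; apply: sP; rewrite inE ys orbT.
Qed.

Lemma is_basis_bij (A : comNzRingType) (V : lmodType A) (J J' : eqType) (v : J -> V)
  (h : J' -> J) : bijective h -> is_basis v -> is_basis (v \o h).
Proof.
case=> h' hK h'K [gen free]; split=> [x|s a us].
  have [s [a ->]] := gen x; exists (map h' s), (a \o h).
  by rewrite big_map; apply: eq_bigr => j _ /=; rewrite h'K.
move=> sum0 j js; have := free (map h s) (a \o h').
rewrite map_inj_uniq; last exact: can_inj hK.
rewrite big_map => /(_ us) free0.
have /free0 : \sum_(j <- s) (a \o h') (h j) *: v (h j) = 0.
  by rewrite -[RHS]sum0; apply: eq_bigr => k _ /=; rewrite hK.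
by move=> /(_ (h j)) /=; rewrite hK; apply; apply: map_f.
Qed.

Theorem theorem2p15 (A : comNzRingType) (f : {poly A}) (n r : nat)
    (n_ : 'I_r -> nat) (f_monic : f \is monic) (f_deg : size f = n.+1)
    (n_le : (\sum_(i < r) n_ i <= n)%N) :
  [/\ monic_ideal block_lt (PF_ideal f n_),
      lead_ideal block_lt (PF_ideal f n_)
        =i ideal_sum (fun i : 'I_r =>
             ideal_exp (block_ideal A i)
               (n - \sum_(k < r | (k <= i)%N) n_ k + 1)%N),
      is_basis (fun m : {m : 'X_{1..(\sum_(i < r) n_ i)%N} |
                    [forall i : 'I_r,
                       (bdeg m i <= n - \sum_(k < r | (i <= k)%N) n_ k)%N]} =>
                  PF_class f ('X_[val m] : {mpoly A[(\sum_(i < r) n_ i)%N]}))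
    & free_of_rank (PF f n_)
        (\prod_(i < r) 'C(n - \sum_(k < r | (i < k)%N) n_ k, n_ i))%N].
Proof.
pose J := {m : 'X_{1..(\sum_(i < r) n_ i)%N} |
  [forall i : 'I_r, (bdeg m i <= n - \sum_(k < r | (i <= k)%N) n_ k)%N]}.
pose e (m : J) := PF_class f ('X_[val m] : {mpoly A[(\sum_(i < r) n_ i)%N]}).
(* Assertions 3 and 4 use the blocks in reverse, so that [standard] sums over the blocks from [i]
   on; assertions 1 and 2 use [nat_of_ord]. *)
pose pri := fun i : 'I_r => (r - i)%N.
have pri_le (i k : 'I_r) : (pri k <= pri i)%N = (i <= k)%N.
  by rewrite /pri leq_sub2lE // ltnW.
have pri_lt (i k : 'I_r) : (pri k < pri i)%N = (i < k)%N by rewrite !ltnNge pri_le.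
have pri_inj : injective pri.
  by move=> i k ik; apply/val_inj/eqP; rewrite eqn_leq -!pri_le ik leqnn.
have stdE m : @standard n r n_ pri m <->
    [forall i : 'I_r, (bdeg m i <= n - \sum_(k < r | (i <= k)%N) n_ k)%N].
  have sumE i : (\sum_(k < r | pri k <= pri i) n_ k = \sum_(k < r | i <= k) n_ k)%N.
    by apply: eq_bigl => k; apply: pri_le.
  split=> [m_std|/forallP m_std i]; last by have := m_std i; rewrite -sumE.
  by apply/forallP => i; rewrite -sumE; apply: m_std.
have basis_e : is_basis e.
  split=> [x|s a us].
    (* Spanning: reduce a representative of the class to standard monomials. *)
    have [] := @reduction A f n r n_ f_monic f_deg n_le pri pri_inj (fun=> True)
      (generic_quotient.repr (x : {ideal_quot (ideal_gen (@PF_gen A f r n_))})) => // q q_std xq.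
    exists (pmap insub (msupp q)), (fun m => q@_(val m)).
    rewrite /e /PF_class residue_combination -[LHS]residue_repr.
    apply/eq_residue; rewrite (_ : \sum_(j <- _) _ = q) //.
    rewrite [RHS]mpolyE; apply: (@sum_pmap_insub _ _ _ _ _ (fun m => q@_m *: 'X_[m])) => m.
    by move=> /q_std [/stdE].
  rewrite /e /PF_class residue_combination -(residue0 (@PF_gen A f r n_)) => /eq_residue.
  rewrite subr0 => sI j js.
  have sum0 : \sum_(j <- s) a j *: 'X_[val j] = 0 :> {mpoly A[\sum_(i < r) n_ i]}.
    apply: (supported_standard_ideal f_monic f_deg n_le pri_inj sI).
    apply: supported_sum => k _; apply: supportedZ; apply: supportedX.
    by apply/stdE; apply: (valP k).
  have := congr1 (mcoeff (val j)) sum0; rewrite mcoeff0 raddf_sum (bigD1_seq j) //=.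
  rewrite mcoeffZ mcoeffX eqxx mulr1 big1 ?addr0 // => k kj.
  by rewrite mcoeffZ mcoeffX (inj_eq val_inj) (negbTE kj) mulr0.
split=> //.
- exists (fun m => ~ standard n (@nat_of_ord r) m) => p.
  apply/idP/idP => [/(lead_idealP f_monic f_deg n_le) /monomial_combination //|].
  move/ideal_gen_monomialsP => pS; apply/(lead_idealP f_monic f_deg n_le)/pS => m u.
  exact: nonstandard_add.
- move=> p; apply/idP/idP.
    by move/(lead_idealP f_monic f_deg n_le)/(block_ideal_sumP (fun i => n - _)%N).
  by move/(block_ideal_sumP (fun i => n - _)%N)/(lead_idealP f_monic f_deg n_le).
(* The rank is obtained by reindexing the basis of assertion 3 along the finite enumeration of the
   standard monomials. *)
- have [J' [v [v_inj vP cardJ']]] := standard_enumeration n_le pri_inj.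
  have v_std j : [forall i : 'I_r, (bdeg (v j) i <= n - \sum_(k < r | (i <= k)%N) n_ k)%N].
    by apply/stdE/vP; exists j.
  pose h (j : J') : J := Sub (v j) (v_std j).
  have h_bij : bijective h.
    have /choice [h' h'K] : forall m : J, exists j, val m = v j.
      by move=> m; apply/vP/stdE/(valP m).
    exists h' => [j|m]; first by apply: v_inj; rewrite -h'K.
    by apply: val_inj; rewrite /= -h'K.
  have cardE : (\prod_(i < r) 'C(n - \sum_(k < r | (i < k)%N) n_ k, n_ i))%N = #|J'|.
    by rewrite cardJ'; apply: eq_bigr => i _; rewrite (eq_bigl _ _ (pri_lt i)).
  rewrite cardE; exists (e \o h \o enum_val).
  apply: is_basis_bij (enum_val_bij J') _.
  exact: is_basis_bij h_bij basis_e.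
Qed.
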